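(* Let $q$ be a complex number with $|q|<1$. Then $$\sum_{m,n\ge 0}\frac{(-1)^n q^{2\binom{m}{2}+9\binom{n}{2}+3mn+2m+7n}}{(q;q)_m (q^3;q^3)_n} = \frac{1}{(q^2,q^3;q^6)_\infty}.$$
   Context: For $n\in\mathbb{N}\cup\{\infty\}$, $(A;q)_n:=\prod_{k=0}^{n-1}(1-Aq^k)$ and $(A_1,\ldots,A_m;q)_n:=(A_1;q)_n\cdots(A_m;q)_n$. *)

(* Defs.v *)
From mathcomp Require Import all_boot all_order all_algebra.
From mathcomp Require Import finmap complex.
From mathcomp Require Import all_classical all_reals all_analysis.
From mathcomp Require Import summability.

Set Implicit Arguments.
Unset Strict Implicit.
Unset Printing Implicit Defensive.

Import GRing.Theory Num.Theory.
Import numFieldNormedType.Exports.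

Local Open Scope classical_set_scope.
Local Open Scope ring_scope.

Definition qpoch (K : numFieldType) (A q : K) (n : nat) : K :=
  \prod_(k < n) (1 - A * q ^+ k).

(* [limn] is a total operator; the limit exists whenever `|q| < 1. *)
Definition qpochinf (K : numFieldType) (A q : K) : K :=
  limn (fun n => qpoch A q n).

Definition qpochsinf (K : numFieldType) (As : seq K) (q : K) : K :=
  \prod_(A <- As) qpochinf A q.

Definition double_summand (K : numFieldType) (q : K) (mn : nat * nat) : K :=
  let: (m, n) := mn in
  (-1) ^+ n * q ^+ (2 * 'C(m, 2) + 9 * 'C(n, 2) + 3 * m * n + 2 * m + 7 * n)
  / (qpoch q q m * qpoch (q ^+ 3) (q ^+ 3) n).

(* Main.v *)
Require Import Defs.
From mathcomp Require Import all_boot all_order all_algebra.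
From mathcomp Require Import finmap complex.
From mathcomp Require Import all_classical all_reals all_analysis.
From mathcomp Require Import summability.
From mathcomp Require Import zify ring lra.

(**
  Assume [q <> 0], write [q = t^3] and [Q = q^3]. The triple sum
    [B_t(N,m,k) = (-1)^(N+m+k) q^(N(N+1)/2 + C(m,2) + 3 C(k+1,2) + k(N-m) + m)
                  t^(N-m) / ((q;q)_m (Q;Q)_k)],  [N] an integer, [m, k >= 0],
  is evaluated in two ways after averaging over the three cube roots [t] of [q].
  The averaging keeps the terms with [N - m = 3l]; by Euler's identity the sum
  over [k] is then [(Q^(l+1);Q)_oo], which vanishes for [l < 0] and leaves
  [(Q;Q)_oo] times the double sum of the theorem.
  Summing instead over [m] with [M = N + k] fixed separates a theta series
  [theta(t) = sum (-1)^M q^(M(M+1)/2) t^M] from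
  [(t^2;q)_oo sum_k (t;q)_k (-t q)^k q^C(k,2) / (Q;Q)_k].
  The last sum is the case [a^3 = q] of
    [g(a) = sum_n (a;q)_n prod_(1<=i<=n) (q^(2i) - a) q^C(n+1,2)
                  / ((Q;Q)_n (a^2 q;q^2)_n)],
  which satisfies
    [(1 - a^2 q)(1 - a^2 q^3) g(a) = (1 - a q)(1 - a^3 q^3) g(a q^2)]
  by telescoping, hence is an infinite product. With Jacobi's triple product the
  total becomes a constant times [theta(t) sum (-1)^k q^(k^2) t^k]; averaged over
  the cube roots, this product of two theta series is, after a change of
  variables of determinant 3, again a product of two theta series, and Jacobi's
  triple product evaluates both of them.
*)

Import Order.TTheory GRing.Theory Num.Theory.
Import numFieldNormedType.Exports.

Set Implicit Arguments.
Unset Strict Implicit.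
Unset Printing Implicit Defensive.

Local Open Scope classical_set_scope.
Local Open Scope ring_scope.
Local Open Scope complex_scope.

#[local] Existing Instance totally_filter.

(** * Unordered sums *)

Section UnorderedSums.
Variable K : numFieldType.
Implicit Types I J : choiceType.

Definition has_sum I (f : I -> K) (s : K) := partial_sum f @ totally --> s.

Lemma partial_sumE I (f : I -> K) (A : {fset I}) :
  partial_sum f A = \sum_(i <- A) f i.
Proof. by rewrite /partial_sum big_seq_fsetE. Qed.

Lemma has_sumP I (f : I -> K) s : has_sum f s <->
  (forall e : K, 0 < e -> exists A : {fset I}, forall B : {fset I},
     (A `<=` B)%fset -> `|s - \sum_(i <- B) f i| < e).
Proof.
split=> [/cvgrPdist_lt H e e0|H].
  have [A _ HA] := H e e0; exists A => B AB.
  by have := HA B AB; rewrite /= partial_sumE.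
apply/cvgrPdist_lt => e e0; have [A HA] := H e e0.
by exists A => // B AB /=; rewrite partial_sumE; exact: HA.
Qed.

Lemma has_sum_unique I (f : I -> K) s s' :
  has_sum f s -> has_sum f s' -> s = s'.
Proof. by move=> Hs Hs'; apply: (cvg_unique _ Hs Hs'). Qed.

Lemma eq_has_sum I (f g : I -> K) s : has_sum f s -> f =1 g -> has_sum g s.
Proof. by move=> + fg; rewrite (_ : f = g)//; apply: funext. Qed.

Lemma has_sumD I (f g : I -> K) s s' :
  has_sum f s -> has_sum g s' -> has_sum (fun i => f i + g i) (s + s').
Proof.
move=> Hf Hg; rewrite /has_sum.
have -> : partial_sum (fun i => f i + g i) = partial_sum f \+ partial_sum g.
  by apply/funext => A; rewrite /partial_sum big_split.
exact: cvgD.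
Qed.

Lemma has_sumZ I (f : I -> K) s c :
  has_sum f s -> has_sum (fun i => c * f i) (c * s).
Proof.
move=> Hf; rewrite /has_sum.
have -> : partial_sum (fun i => c * f i) = (fun A => c * partial_sum f A).
  by apply/funext => A; rewrite /partial_sum mulr_sumr.
by apply: cvgM => //; exact: cvg_cst.
Qed.

Arguments has_sumZ {I f s} c _.

Lemma has_sumB I (f g : I -> K) s s' :
  has_sum f s -> has_sum g s' -> has_sum (fun i => f i - g i) (s - s').
Proof.
move=> Hf Hg; have := has_sumD Hf (has_sumZ (-1) Hg); rewrite mulN1r.
by move/eq_has_sum; apply => i; rewrite mulN1r.
Qed.

Lemma has_sum0 I : has_sum (fun _ : I => 0) 0.
Proof.
rewrite /has_sum (_ : partial_sum _ = fun=> 0); first exact: cvg_cst.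
by apply/funext => A; rewrite /partial_sum big1.
Qed.

Lemma has_sum_bigop I L (r : seq L) (f : L -> I -> K) (s : L -> K) :
  (forall k, has_sum (f k) (s k)) ->
  has_sum (fun i => \sum_(k <- r) f k i) (\sum_(k <- r) s k).
Proof.
move=> H; elim: r => [|k r IH].
  by rewrite big_nil; apply: (eq_has_sum (has_sum0 _)) => i; rewrite big_nil.
rewrite big_cons; apply: (eq_has_sum (has_sumD (H k) IH)) => i.
by rewrite big_cons.
Qed.

Arguments has_sum_bigop {I L} r {f s} _.

Lemma sum_fsetX I J (f : I * J -> K) (A : {fset I}) (B : {fset J}) :
  \sum_(p <- (A `*` B)%fset) f p = \sum_(i <- A) \sum_(j <- B) f (i, j).
Proof.
rewrite (perm_big [seq (i, j) | i <- enum_fset A, j <- enum_fset B]) /=.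
  by rewrite big_allpairs.
apply: uniq_perm; first exact: fset_uniq.
  by rewrite allpairs_uniq ?fset_uniq // => -[? ?] [? ?] _ _ [-> ->].
move=> [i j]; rewrite in_fsetM /=; apply/idP/allpairsP => [/andP[iA jB]|].
  by exists (i, j).
by case=> -[i' j'] /= [iA jB [-> ->]]; rewrite iA jB.
Qed.

(** For a finite set [B] of rows containing those of [A0], a single finite set [J1] of columns does
    two jobs: [B] times [J1] contains [A0], and restricting the rows of [B] to [J1] changes the
    total of their sums by less than e/2. *)
Lemma has_sum_fubini I J (f : I * J -> K) (g : I -> K) s :
  has_sum f s -> (forall i, has_sum (fun j => f (i, j)) (g i)) -> has_sum g s.
Proof.
move=> /has_sumP Hf Hg; apply/has_sumP => e e0.
have e20 : 0 < e / 2 by rewrite divr_gt0.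
have [A0 HA0] := Hf _ e20.
exists [fset p.1 | p in A0]%fset => B AB.
have /has_sumP/(_ _ e20)[J0 HJ0] := has_sum_bigop B Hg.
pose J1 := (J0 `|` [fset p.2 | p in A0])%fset.
have /HJ0 H1 : (J0 `<=` J1)%fset by rewrite fsubsetUl.
have /HA0 H2 : (A0 `<=` B `*` J1)%fset.
  apply/fsubsetP => -[i j] ij; rewrite in_fsetM /=; apply/andP; split.
    by apply: (fsubsetP AB); apply/imfsetP; exists (i, j).
  by rewrite in_fsetU; apply/orP; right; apply/imfsetP; exists (i, j).
rewrite sum_fsetX in H2; rewrite exchange_big /= in H1.
rewrite (splitr e); apply: le_lt_trans (ltrD H2 H1).
by rewrite (distrC (\sum_(i <- B) g i)); apply: ler_distD.
Qed.

(** The condition on [psi] says that [f] vanishes off the image of [phi], so both bijective changes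
    of variables and parametrizations of the support are covered. *)
Lemma has_sum_reindex I J (phi : I -> J) (psi : J -> I) (f : J -> K) s :
  cancel phi psi -> (forall j, phi (psi j) != j -> f j = 0) ->
  has_sum f s <-> has_sum (f \o phi) s.
Proof.
move=> phiK f0; have phi_inj := can_inj phiK.
split=> /has_sumP H; apply/has_sumP => e e0; have [A HA] := H e e0.
- exists (psi @` A)%fset => B AB.
  have -> : \sum_(i <- B) (f \o phi) i = \sum_(j <- (phi @` B)%fset) f j.
    by rewrite big_imfset //= => x y _ _; exact: phi_inj.
  have -> : \sum_(j <- (phi @` B)%fset) f j =
            \sum_(j <- ((phi @` B) `|` A)%fset) f j.
    apply: big_fset_incl; first by rewrite fsubsetUl.
    move=> j; rewrite in_fsetU => /orP[->//|jA] jB; apply: f0.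
    apply: contra jB => /eqP <-; apply/imfsetP; exists (psi j) => //=.
    by apply: (fsubsetP AB); apply/imfsetP; exists j.
  by apply: HA; rewrite fsubsetUr.
- exists (phi @` A)%fset => B AB.
  pose B' := [fset j in B | phi (psi j) == j]%fset.
  have -> : \sum_(j <- B) f j = \sum_(j <- B') f j.
    apply/esym/big_fset_incl; first by apply: fset_sub.
    by move=> j jB; rewrite !inE jB /= => /f0.
  have -> : \sum_(j <- B') f j = \sum_(i <- (psi @` B')%fset) (f \o phi) i.
    rewrite [RHS]big_imfset /=.
      by apply: eq_fbigr => j; rewrite !inE => /andP[_ /eqP ->] _.
    move=> x y; rewrite !inE => /andP[_ /eqP <-] /andP[_ /eqP <-].
    by rewrite !phiK => ->.
  apply: HA; apply/fsubsetP => i iA; apply/imfsetP; exists (phi i) => /=.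
    rewrite !inE phiK eqxx andbT.
    by apply: (fsubsetP AB); apply/imfsetP; exists i.
  by rewrite phiK.
Qed.

Lemma has_sum1 I (i0 : I) c : has_sum (fun i => if i == i0 then c else 0) c.
Proof.
apply/has_sumP => e e0; exists [fset i0]%fset => B; rewrite fsub1set => iB.
rewrite (big_fsetD1 i0) //= eqxx big1_fset ?addr0 ?subrr ?normr0 // => i.
by rewrite !inE => /andP[/negPf ->].
Qed.

Lemma has_sum_S (f : nat -> K) s :
  has_sum f s -> f 0%N = 0 -> has_sum (fun n => f n.+1) s.
Proof.
move=> fs f0.
have H1 j : (j.-1).+1 != j -> f j = 0 by case: j => [|j] //=; rewrite eqxx.
by have [+ _] := has_sum_reindex s (phi := S) (psi := predn) succnK H1; apply.
Qed.

End UnorderedSums.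
Arguments has_sumZ {K I f s} c _.
Arguments has_sum_bigop {K I L} r {f s} _.

(** * Nonnegative real families with bounded finite sums *)

Section BoundedSums.
Variable R : realType.
Implicit Types I J : choiceType.

Definition bdd_sums I (g : I -> R) :=
  (forall i, 0 <= g i) /\
  exists M, forall A : {fset I}, \sum_(i <- A) g i <= M.

Lemma le_sum_fset_sub I (g : I -> R) (A B : {fset I}) :
  (forall i, 0 <= g i) -> (A `<=` B)%fset ->
  \sum_(i <- A) g i <= \sum_(i <- B) g i.
Proof.
move=> g0 AB; rewrite [leRHS](big_fsetID _ (mem A)) /=.
have -> : [fset x in B | x \in A]%fset = A.
  apply/fsetP => x; rewrite !inE /=; apply/andP/idP => [[]//|xA]; split => //.
  exact: (fsubsetP AB).
by rewrite lerDl sumr_ge0.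
Qed.

Lemma le_bdd_sums I (g h : I -> R) :
  bdd_sums g -> (forall i, 0 <= h i <= g i) -> bdd_sums h.
Proof.
move=> [_ [M HM]] hg; split=> [i|]; first by case/andP: (hg i).
exists M => A; apply: le_trans (HM A); apply: ler_sum => i _.
by case/andP: (hg i).
Qed.

Lemma bdd_sumsD I (g h : I -> R) :
  bdd_sums g -> bdd_sums h -> bdd_sums (fun i => g i + h i).
Proof.
move=> [g0 [M HM]] [h0 [N HN]]; split=> [i|]; first exact: addr_ge0.
by exists (M + N) => A; rewrite big_split lerD.
Qed.

Lemma bdd_sumsZ I (g : I -> R) c :
  0 <= c -> bdd_sums g -> bdd_sums (fun i => c * g i).
Proof.
move=> c0 [g0 [M HM]]; split=> [i|]; first exact: mulr_ge0.
by exists (c * M) => A; rewrite -mulr_sumr ler_wpM2l.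
Qed.

Lemma bdd_sums_prod I J (g : I -> R) (h : J -> R) :
  bdd_sums g -> bdd_sums h -> bdd_sums (fun p : I * J => g p.1 * h p.2).
Proof.
move=> [g0 [M HM]] [h0 [N HN]]; split=> [p|]; first exact: mulr_ge0.
exists (M * N) => A.
pose A1 := [fset p.1 | p in A]%fset; pose A2 := [fset p.2 | p in A]%fset.
have sub : (A `<=` A1 `*` A2)%fset.
  apply/fsubsetP => p pA; rewrite in_fsetM; apply/andP.
  by split; apply/imfsetP; exists p.
apply: le_trans (le_sum_fset_sub _ sub) _; first by move=> p; exact: mulr_ge0.
rewrite sum_fsetX /=.
under eq_bigr do rewrite -mulr_sumr.
rewrite -mulr_suml ler_pM ?sumr_ge0 //.
Qed.

Lemma bdd_sums_comp I J (phi : I -> J) (g : J -> R) :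
  injective phi -> bdd_sums g -> bdd_sums (g \o phi).
Proof.
move=> phi_inj [g0 [M HM]]; split=> [i|]; first exact: g0.
exists M => A; apply: le_trans (HM (phi @` A)%fset).
by rewrite big_imfset //= => x y _ _; exact: phi_inj.
Qed.

Lemma bdd_sums_geom (r : R) : 0 <= r < 1 -> bdd_sums (fun n : nat => r ^+ n).
Proof.
case/andP=> r0 r1; split=> [n|]; first exact: exprn_ge0.
exists (1 - r)^-1 => A.
have [N HN] : exists N, forall i, i \in A -> (i < N)%N.
  by exists (\max_(i <- A) i)%N.+1 => i iA; rewrite ltnS leq_bigmax_seq.
have /(le_sum_fset_sub _) le1 : (A `<=` [fset i in iota 0 N])%fset.
  by apply/fsubsetP => i iA; rewrite !inE mem_iota /= HN.
apply: le_trans (le1 _ _) _ => [i|]; first exact: exprn_ge0.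
rewrite (perm_big (iota 0 N)) /=; last first.
  by apply: uniq_perm; rewrite ?fset_uniq ?iota_uniq // => i; rewrite !inE.
have := subrX1 r N; rewrite -(big_mkord xpredT (fun i => r ^+ i)) /index_iota subn0.
set S := \sum_(i <- iota 0 N) _ => E.
have ir0 : 0 < 1 - r by rewrite subr_gt0.
rewrite -[leRHS]mul1r ler_pdivlMr //.
have -> : S * (1 - r) = 1 - r ^+ N by rewrite mulrC -opprB mulNr -E opprB.
by rewrite lerBlDr lerDl exprn_ge0.
Qed.

Lemma bdd_sums_sup I (g : I -> R) : bdd_sums g ->
  exists s, forall e, 0 < e -> exists A : {fset I}, forall B : {fset I},
    (A `<=` B)%fset -> s - e < \sum_(i <- B) g i <= s.
Proof.
move=> [g0 [M HM]].
pose E := [set x : R | exists A : {fset I}, x = \sum_(i <- A) g i].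
have supE : has_sup E.
  split; first by exists 0, fset0; rewrite big_seq_fset0.
  by exists M => _ [A ->].
exists (sup E) => e e0; have [_ [A ->] HA] := sup_adherent e0 supE.
exists A => B AB; apply/andP; split.
  exact: lt_le_trans HA (le_sum_fset_sub g0 AB).
by apply: sup_upper_bound => //; exists B.
Qed.

(** Write [h] as [(h + g) - g]: both families are nonnegative, and the first is at most [2 g]. *)
Lemma real_dominated_sum I (h g : I -> R) :
  bdd_sums g -> (forall i, `|h i| <= g i) ->
  exists s, forall e, 0 < e -> exists A : {fset I}, forall B : {fset I},
    (A `<=` B)%fset -> `|s - \sum_(i <- B) h i| < e.
Proof.
move=> bg hg; have [g0 _] := bg.
have bh : bdd_sums (fun i => h i + g i).
  apply: (le_bdd_sums (bdd_sumsD bg bg)) => i.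
  by have := hg i; rewrite ler_norml => /andP[h1 h2]; apply/andP; split; lra.
have [s1 H1] := bdd_sums_sup bh; have [s2 H2] := bdd_sums_sup bg.
exists (s1 - s2) => e e0.
have [A1 HA1] := H1 e e0; have [A2 HA2] := H2 e e0.
exists (A1 `|` A2)%fset => B AB.
have := HA1 B (fsubset_trans (fsubsetUl _ _) AB).
have := HA2 B (fsubset_trans (fsubsetUr _ _) AB).
rewrite big_split /=.
set x := \sum_(i <- B) h i; set y := \sum_(i <- B) g i => /andP[a1 a2] /andP[b1 b2].
by rewrite ltr_norml; apply/andP; split; lra.
Qed.

End BoundedSums.

(** * Dominated complex families and Tannery's theorem *)

Section DominatedSums.
Variable R : realType.
Local Notation C := (R[i] : numFieldType).
Implicit Types I J : choiceType.

Definition dominated I (f : I -> C) (g : I -> R) :=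
  forall i, `|f i| <= (g i)%:C.

Lemma posC (e : C) : 0 < e -> exists2 r : R, 0 < r & e = r%:C.
Proof.
case: e => a b; rewrite ltcE /= => /andP[/eqP-> a0].
by exists a.
Qed.

Lemma normC_real (x : R) : `|x%:C| = `|x|%:C :> C.
Proof. by rewrite normc_def /= expr0n /= addr0 sqrtr_sqr. Qed.

Lemma normC_le_ReIm (z : C) : `|z| <= (`|complex.Re z| + `|complex.Im z|)%:C.
Proof.
rewrite {1}[z]complexE; apply: le_trans (ler_normD _ _) _.
rewrite normrM !normC_real rmorphD lerD2l.
by rewrite (_ : `|'i| = 1) ?mul1r // normc_def /= expr0n expr1n add0r sqrtr1.
Qed.

Lemma normC_ge_Im (z : C) : `|complex.Im z|%:C <= `|z|.
Proof.
rewrite normc_def lecR -sqrtr_sqr ler_wsqrtr //.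
by rewrite lerDr sqr_ge0.
Qed.

Lemma dominated_has_sum I (f : I -> C) g :
  bdd_sums g -> dominated f g -> exists s, has_sum f s.
Proof.
move=> bg fg.
have [a Ha] : exists s, forall e, 0 < e -> exists A : {fset I}, forall B : {fset I},
    (A `<=` B)%fset -> `|s - \sum_(i <- B) complex.Re (f i)| < e.
  apply: (real_dominated_sum bg) => i.
  by have := le_trans (normc_ge_Re (f i)) (fg i); rewrite lecR.
have [b Hb] : exists s, forall e, 0 < e -> exists A : {fset I}, forall B : {fset I},
    (A `<=` B)%fset -> `|s - \sum_(i <- B) complex.Im (f i)| < e.
  apply: (real_dominated_sum bg) => i.
  by have := le_trans (normC_ge_Im (f i)) (fg i); rewrite lecR.
exists (a +i* b); apply/has_sumP => _ /posC[e e0 ->].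
have e20 : 0 < e / 2 by rewrite divr_gt0.
have [A HA] := Ha _ e20; have [A' HA'] := Hb _ e20.
exists (A `|` A')%fset => B AB.
apply: le_lt_trans (normC_le_ReIm _) _; rewrite ltcR.
have -> : complex.Re ((a +i* b) - \sum_(i <- B) f i) = a - \sum_(i <- B) complex.Re (f i).
  by rewrite raddfB /= (raddf_sum (@complex.Re R)).
have -> : complex.Im ((a +i* b) - \sum_(i <- B) f i) = b - \sum_(i <- B) complex.Im (f i).
  by rewrite raddfB /= (raddf_sum (@complex.Im R)).
rewrite (splitr e) ltrD //.
  by apply: HA; apply: fsubset_trans AB; rewrite fsubsetUl.
by apply: HA'; apply: fsubset_trans AB; rewrite fsubsetUr.
Qed.

(** The set [A] is chosen from [g] and [e] alone, before [f]. This uniformity in [f] is what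
    [tannery] rests on: outside [A] every finite sum of [g] is below [e]. *)
Lemma dominated_tail I (g : I -> R) (e : R) : bdd_sums g -> 0 < e ->
  exists A : {fset I}, forall (f : I -> C) s, dominated f g -> has_sum f s ->
    `|s - \sum_(i <- A) f i| <= e%:C.
Proof.
move=> bg e0; have [sg Hg] := bdd_sums_sup bg; have [A HA] := Hg e e0.
exists A => f s fg /has_sumP fs; apply/ler_addgt0Pr => e' e'0.
have [A' HA'] := fs _ e'0.
have /HA' lt1 : (A' `<=` A `|` A')%fset by rewrite fsubsetUr.
have /HA/andP[_ le2] : (A `<=` A `|` A')%fset by rewrite fsubsetUl.
have /andP[le3 _] := HA A (fsubset_refl _).
set B := (A `|` A')%fset in lt1 le2.
have splitB (T : zmodType) (h : I -> T) : \sum_(i <- B) h i =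
    \sum_(i <- A) h i + \sum_(i <- [fset x in B | x \notin A]%fset) h i.
  rewrite (big_fsetID _ (mem A)) /=; congr (_ + _); apply: eq_fbigl => x.
  by rewrite !inE; case: (x \in A); rewrite ?andbT ?andbF.
have -> : s - \sum_(i <- A) f i = (s - \sum_(i <- B) f i) +
   \sum_(i <- [fset x in B | x \notin A]%fset) f i by rewrite splitB; ring.
rewrite addrC; apply: le_trans (ler_normD _ _) _; rewrite lerD //; last first.
  exact: ltW.
apply: le_trans (ler_norm_sum _ _ _) _.
apply: (@le_trans _ _ (\sum_(i <- [fset x in B | x \notin A]%fset) (g i)%:C)).
  by apply: ler_sum => i _; exact: fg.
rewrite -rmorph_sum lecR.
by move: le2; rewrite splitB; lra.
Qed.

(** By [dominated_tail] one finite set truncates [f0] and all the [f n] with error at most e/4; on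
    that set pointwise convergence suffices. *)
Lemma tannery I (f : nat -> I -> C) (f0 : I -> C) (s : nat -> C) (s0 : C) g :
  bdd_sums g -> (forall n, dominated (f n) g) -> dominated f0 g ->
  (forall n, has_sum (f n) (s n)) -> has_sum f0 s0 ->
  (forall i, (fun n => f n i) @ \oo --> f0 i) -> s @ \oo --> s0.
Proof.
move=> bg fg f0g fs f0s fi; apply/cvgrPdist_lt => _ /posC[e e0 ->].
have e40 : 0 < e / 4 by rewrite divr_gt0.
have [A HA] := dominated_tail bg e40.
have : (fun n => \sum_(i <- A) f n i) @ \oo --> \sum_(i <- A) f0 i.
  elim: (enum_fset A) => [|i r IH].
    by under eq_fun do rewrite big_nil; rewrite big_nil; exact: cvg_cst.
  rewrite big_cons (_ : (fun n => _) =
    (fun n => f n i) \+ (fun n => \sum_(j <- r) f n j)); last first.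
    by apply/funext => n; rewrite big_cons.
  by apply: cvgD; [exact: fi | exact: IH].
have e40' : 0 < (e / 4)%:C :> C by rewrite ltcR.
move=> /cvgrPdist_lt/(_ _ e40') [N _ HN].
exists N => // n Nn /=; have /= lt1 := HN n Nn.
have := HA _ _ f0g f0s; have := HA _ _ (fg n) (fs n) => le1 le2.
have -> : s0 - s n = (s0 - \sum_(i <- A) f0 i) +
   (\sum_(i <- A) f0 i - \sum_(i <- A) f n i) - (s n - \sum_(i <- A) f n i).
  by ring.
apply: le_lt_trans (ler_normB _ _) _.
apply: (@le_lt_trans _ _ ((e / 4)%:C + (e / 4)%:C + (e / 4)%:C)).
  rewrite lerD //; apply: le_trans (ler_normD _ _) _; rewrite lerD //; exact: ltW.
by rewrite -!rmorphD ltcR /=; lra.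
Qed.

Lemma has_sum_series (f : nat -> C) s :
  has_sum f s -> (fun n => \sum_(k < n) f k) @ \oo --> s.
Proof.
move=> /has_sumP fs; apply/cvgrPdist_lt => e e0; have [A HA] := fs e e0.
exists (\max_(i <- A) i)%N.+1 => // n /= An.
rewrite -(big_mkord xpredT f) /index_iota subn0.
rewrite (perm_big (enum_fset [fset i in iota 0 n]%fset)) /=; last first.
  by apply: uniq_perm; rewrite ?fset_uniq ?iota_uniq // => i; rewrite !inE.
apply: HA; apply/fsubsetP => i iA; rewrite !inE mem_iota /=.
by apply: leq_ltn_trans An; rewrite leq_bigmax_seq.
Qed.

End DominatedSums.

(** * Absolutely summable complex families *)

Section AbsoluteSums.
Variable R : realType.
Local Notation C := (R[i] : numFieldType).
Implicit Types I J : choiceType.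

(* The complex modulus as an element of [R]: in [R[i]] the norm is complex. *)
Definition nr (z : C) : R := complex.Re `|z|.

Lemma nrE (z : C) : `|z| = (nr z)%:C.
Proof. by rewrite /nr normc_def. Qed.

Lemma nr_ge0 z : 0 <= nr z.
Proof. by have := normr_ge0 z; rewrite nrE lecR. Qed.

Lemma nrM x y : nr (x * y) = nr x * nr y.
Proof.
by apply: (@complexI R); rewrite rmorphM /= -!nrE normrM.
Qed.

Lemma nr0 : nr 0 = 0. Proof. by rewrite /nr normr0. Qed.

Lemma nr1 : nr 1 = 1. Proof. by rewrite /nr normr1. Qed.

Lemma nrN x : nr (- x) = nr x. Proof. by rewrite /nr normrN. Qed.

Lemma nrX x n : nr (x ^+ n) = nr x ^+ n.
Proof. by elim: n => [|n IH]; rewrite ?nr1 // !exprS nrM IH. Qed.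

Lemma nrV x : nr x^-1 = (nr x)^-1.
Proof.
by apply: (@complexI R); rewrite fmorphV /= -!nrE normfV.
Qed.

Lemma nr_gt0 x : (0 < nr x) = (x != 0).
Proof. by rewrite -normr_gt0 nrE ltcR. Qed.

Lemma nr_leD x y : nr (x + y) <= nr x + nr y.
Proof. by have := ler_normD x y; rewrite !nrE -rmorphD lecR. Qed.

Lemma nr_leB x y : nr (x - y) <= nr x + nr y.
Proof. by rewrite -(nrN y) nr_leD. Qed.

Lemma nr_geB x y : nr x - nr y <= nr (x - y).
Proof. by have := nr_leD (x - y) y; rewrite subrK; lra. Qed.

Lemma nr_lt1 x : (nr x < 1) = (`|x| < 1).
Proof. by rewrite nrE -(rmorph1 (real_complex R)) ltcR. Qed.

Lemma cvg_nr (f : nat -> C) (l : C) (u : nat -> R) :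
  (forall n, nr (l - f n) <= u n) -> u @ \oo --> (0 : R) -> f @ \oo --> l.
Proof.
move=> fu /cvgrPdist_lt u0; apply/cvgrPdist_lt => _ /posC[e e0 ->].
have [N _ HN] := u0 e e0; exists N => // n Nn /=; rewrite nrE ltcR.
apply: le_lt_trans (fu n) _; apply: le_lt_trans (HN n Nn) => /=.
by rewrite sub0r normrN ler_norm.
Qed.

Lemma expr_small (r e : R) : 0 <= r < 1 -> 0 < e ->
  exists N, forall n, (N <= n)%N -> r ^+ n <= e.
Proof.
move=> /andP[r0 r1] e0; have r1' : `|r| < 1 by rewrite ger0_norm.
have /cvgrPdist_lt/(_ e e0)[N _ HN] := cvg_expr r1'.
exists N => n /HN /=; rewrite sub0r normrN => /ltW.
exact: le_trans (ler_norm _).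
Qed.

Lemma bdd_sums_ratio (u : nat -> R) (r : R) N :
  (forall n, 0 <= u n) -> 0 < r < 1 ->
  (forall n, (N <= n)%N -> u n.+1 <= r * u n) -> bdd_sums u.
Proof.
move=> u0 /andP[r0 r1] ur; have r01 : 0 <= r < 1 by rewrite ltW.
(* The constant [M] secures [u n <= M * r ^+ n] for [n <= N]; the ratio bound carries this to all
   larger [n]. *)
pose M := \sum_(i < N.+1) u i / r ^+ i.
have M0 : 0 <= M by apply: sumr_ge0 => i _; rewrite divr_ge0 ?u0 ?exprn_ge0 ?ltW.
have leM n : (n <= N)%N -> u n <= M * r ^+ n.
  move=> nN; rewrite -ler_pdivrMr ?exprn_gt0 // /M.
  rewrite (bigD1 (Ordinal (nN : (n < N.+1)%N))) //= lerDl sumr_ge0 // => i _.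
  by rewrite divr_ge0 ?u0 ?exprn_ge0 ?ltW.
apply: (le_bdd_sums (bdd_sumsZ M0 (bdd_sums_geom r01))) => n.
rewrite u0 /=; elim: n => [|n IH]; first exact: leM.
have [nN|Nn] := leqP n.+1 N; first exact: leM.
apply: le_trans (ur n Nn) _; by rewrite exprS mulrCA ler_wpM2l // ltW.
Qed.

Definition asum I (f : I -> C) := bdd_sums (nr \o f).

Lemma asum_has_sum I (f : I -> C) : asum f -> exists s, has_sum f s.
Proof.
by move=> af; apply: (dominated_has_sum af) => i; rewrite nrE.
Qed.

Lemma asum_comp I J (phi : I -> J) (f : J -> C) :
  injective phi -> asum f -> asum (f \o phi).
Proof. by move=> phi_inj /(bdd_sums_comp phi_inj). Qed.

Lemma asum_prod I J (f : I -> C) (g : J -> C) :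
  asum f -> asum g -> asum (fun p : I * J => f p.1 * g p.2).
Proof.
move=> af ag; have := bdd_sums_prod af ag.
by congr bdd_sums; apply/funext => p /=; rewrite nrM.
Qed.

Lemma has_sum_prod I J (f : I -> C) (g : J -> C) s s' :
  asum f -> asum g -> has_sum f s -> has_sum g s' ->
  has_sum (fun p : I * J => f p.1 * g p.2) (s * s').
Proof.
move=> af ag fs gs; have [S HS] := asum_has_sum (asum_prod af ag).
suff <- : S = s * s' by [].
have rows i : has_sum (fun j => f i * g j) (f i * s') := has_sumZ (f i) gs.
have /has_sum_unique := has_sum_fubini HS rows; apply.
by rewrite mulrC; apply: (eq_has_sum (has_sumZ s' fs)) => i; rewrite mulrC.
Qed.

Lemma asum_int (f : int -> C) :
  asum (fun n : nat => f n%:Z) -> asum (fun n : nat => f (Negz n)) -> asum f.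
Proof.
move=> [_ [M HM]] [_ [N HN]]; split=> [n|]; first exact: nr_ge0.
exists (M + N) => A; rewrite (big_fsetID _ (fun n : int => 0 <= n)) /=.
apply: lerD.
- set A0 := [fset n in A | 0 <= n]%fset; pose B := [fset absz n | n in A0]%fset.
  apply: le_trans (HM B); rewrite /B [leRHS]big_imfset /=; last first.
    by move=> m n; rewrite !inE => /andP[_ m0] /andP[_ n0]; lia.
  rewrite le_eqVlt; apply/orP; left; apply/eqP; apply: eq_fbigr => n.
  by rewrite !inE => /andP[_ n0] _; rewrite gez0_abs.
- set A0 := [fset n in A | ~~ (0 <= n)]%fset.
  (* [Negz k] stands for -(k+1), so a negative [n] has index [(absz n).-1]. *)
  pose B := [fset (absz n).-1 | n in A0]%fset.
  apply: le_trans (HN B); rewrite /B [leRHS]big_imfset /=; last first.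
    by move=> m n; rewrite !inE => /andP[_ m0] /andP[_ n0]; lia.
  rewrite le_eqVlt; apply/orP; left; apply/eqP; apply: eq_fbigr => n.
  by rewrite !inE => /andP[_ n0] _; congr (nr (f _)); rewrite NegzE; lia.
Qed.

End AbsoluteSums.

(** * Euler's identities and infinite products *)

Section QSeries.
Variable R : realType.
Local Notation C := (R[i] : numFieldType).
Implicit Types p x y : C.

Lemma qpochS (x p : C) n : qpoch x p n.+1 = qpoch x p n * (1 - x * p ^+ n).
Proof. by rewrite /qpoch big_ord_recr. Qed.

Lemma qpoch0 (x p : C) : qpoch x p 0 = 1.
Proof. by rewrite /qpoch big_ord0. Qed.

Lemma qpochSl (x p : C) n : qpoch x p n.+1 = (1 - x) * qpoch (x * p) p n.
Proof.
rewrite /qpoch big_ord_recl expr0 mulr1; congr (_ * _).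
by apply: eq_bigr => i _; rewrite /= exprS mulrA.
Qed.

Lemma norm_neq1 (x : C) : `|x| < 1 -> 1 - x != 0.
Proof. by move=> x1; rewrite subr_eq0; apply: contraTneq x1 => <-; rewrite normr1 ltxx. Qed.

Lemma normXlt1 (x : C) n : `|x| < 1 -> `|x ^+ n.+1| < 1.
Proof. by move=> x1; rewrite normrX exprn_ilt1. Qed.

Lemma normMXlt1 (x p : C) n : `|x| < 1 -> `|p| < 1 -> `|x * p ^+ n| < 1.
Proof.
move=> x1 p1; rewrite normrM normrX.
by apply: le_lt_trans x1; rewrite ler_piMr // exprn_ile1 // ltW.
Qed.

Lemma qpoch_neq0 (x p : C) n : `|x| < 1 -> `|p| < 1 -> qpoch x p n != 0.
Proof.
by move=> x1 p1; apply/prodf_neq0 => i _; apply: norm_neq1; exact: normMXlt1.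
Qed.

(* Term of Euler's series for (x;p)_oo. *)
Definition eul p x (m : nat) : C := p ^+ 'C(m, 2) * (- x) ^+ m / qpoch p p m.

(* Term of Euler's series for 1/(y;p)_oo. *)
Definition cau p y (r : nat) : C := y ^+ r / qpoch p p r.

Lemma nr1B p n : nr p < 1 -> 1 - nr p <= nr (1 - p ^+ n.+1).
Proof.
move=> p1; apply: le_trans (nr_geB _ _); rewrite nr1 nrX.
by rewrite lerD2l lerN2 exprS ler_piMr ?nr_ge0 // exprn_ile1 ?nr_ge0 // ltW.
Qed.

Lemma asum_eul p x : `|p| < 1 -> asum (eul p x).
Proof.
rewrite -nr_lt1 => p1; have p0 := nr_ge0 p.
(* The ratio of consecutive terms is -x p^n / (1 - p^(n+1)); once |p|^n is below this threshold, its
   modulus is at most 1/2. The added 1 keeps the denominator positive when x = 0. *)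
have e0 : 0 < (1 - nr p) / (2 * (nr x + 1)).
  by rewrite divr_gt0 ?subr_gt0 // mulr_gt0 // ltr_wpDl ?nr_ge0.
have p01 : 0 <= nr p < 1 by rewrite p0.
have [N HN] := expr_small p01 e0.
apply: (@bdd_sums_ratio _ _ 2^-1 N) => [n||n Nn /=].
- exact: nr_ge0.
- by apply/andP; split; lra.
rewrite /eul qpochS -exprS binS bin1 exprD exprS invfM.
have -> : p ^+ 'C(n, 2) * p ^+ n * (- x * (- x) ^+ n) *
   ((qpoch p p n)^-1 * (1 - p ^+ n.+1)^-1) =
   (p ^+ n * - x / (1 - p ^+ n.+1)) *
   (p ^+ 'C(n, 2) * (- x) ^+ n / qpoch p p n) by ring.
rewrite [leLHS]nrM ler_wpM2r ?nr_ge0 // 2!nrM nrX nrN nrV.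
have h1 := HN n Nn; have h2 := nr1B n p1.
have h3 : 0 < 1 - nr p by rewrite subr_gt0.
rewrite ler_pdivrMr; last exact: lt_le_trans h2.
apply: (@le_trans _ _ (2^-1 * (1 - nr p))); last by rewrite ler_wpM2l.
have x1 : 0 < nr x + 1 by rewrite ltr_wpDl ?nr_ge0.
apply: (@le_trans _ _ (nr p ^+ n * (nr x + 1))).
  by rewrite ler_wpM2l ?exprn_ge0 // lerDl.
rewrite -ler_pdivlMr //; apply: le_trans h1 _.
by rewrite le_eqVlt; apply/orP; left; apply/eqP; field; rewrite gt_eqF.
Qed.

Lemma asum_cau p y : `|p| < 1 -> `|y| < 1 -> asum (cau p y).
Proof.
rewrite -!nr_lt1 => p1 y1; have p0 := nr_ge0 p; have y0 := nr_ge0 y.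
(* The ratio of consecutive terms tends to y in modulus, so the midpoint of |y| and 1 eventually
   bounds it. *)
pose r := (1 + nr y) / 2.
have r0 : 0 < r by rewrite /r; lra.
have ry : nr y < r by rewrite /r; lra.
have e0 : 0 < 1 - nr y / r by rewrite subr_gt0 ltr_pdivrMr ?mul1r.
have p01 : 0 <= nr p < 1 by rewrite p0.
have [N HN] := expr_small p01 e0.
apply: (@bdd_sums_ratio _ _ r N) => [n||n Nn /=].
- exact: nr_ge0.
- by rewrite r0 /= /r; lra.
rewrite /cau qpochS -exprS exprS invfM.
have -> : y * y ^+ n * ((qpoch p p n)^-1 * (1 - p ^+ n.+1)^-1) =
   (y / (1 - p ^+ n.+1)) * (y ^+ n / qpoch p p n) by ring.
rewrite [leLHS]nrM ler_wpM2r ?nr_ge0 // nrM nrV.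
have h2 : 1 - nr p ^+ n.+1 <= nr (1 - p ^+ n.+1).
  by apply: le_trans (nr_geB _ _); rewrite nr1 nrX.
have h1 : nr y / r <= 1 - nr p ^+ n.+1.
  by have := HN n.+1 (leqW Nn); lra.
rewrite ler_pdivrMr; last first.
  apply: lt_le_trans h2; rewrite subr_gt0 exprn_ilt1 //.
by rewrite mulrC -ler_pdivrMr //; apply: le_trans h2.
Qed.

End QSeries.

Section InfiniteProducts.
Variable R : realType.
Local Notation C := (R[i] : numFieldType).
Implicit Types p x y : C.

Lemma cvg_expr0 p : `|p| < 1 -> (fun n => p ^+ n) @ \oo --> (0 : C).
Proof.
rewrite -nr_lt1 => p1; apply: (cvg_nr (u := fun n => nr p ^+ n)).
  by move=> n; rewrite sub0r nrN nrX.
by apply: cvg_expr; rewrite ger0_norm ?nr_ge0.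
Qed.

Lemma cvg_mulX x p : `|p| < 1 -> (fun n => x * p ^+ n) @ \oo --> (0 : C).
Proof.
move=> p1; rewrite -[X in _ --> X](mulr0 x).
by apply: cvgM; [exact: cvg_cst | exact: cvg_expr0].
Qed.

Lemma eulE p x m : eul p x m = p ^+ 'C(m, 2) * (-1) ^+ m / qpoch p p m * x ^+ m.
Proof.
rewrite /eul (exprNn x).
by move: ((-1) ^+ m) (x ^+ m) (qpoch p p m)^-1 (p ^+ 'C(m, 2)) => a b c d; ring.
Qed.

Lemma cauE p y m : cau p y m = (qpoch p p m)^-1 * y ^+ m.
Proof. by rewrite /cau mulrC. Qed.

(** Subtracting the series at xp from the series at x cancels the constant terms, and the difference
    at index k+1 is -x times the k-th term of the series at xp. *)
Lemma has_sum_eul_shift p x s s' : `|p| < 1 ->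
  has_sum (eul p x) s -> has_sum (eul p (x * p)) s' -> s = (1 - x) * s'.
Proof.
move=> p1 H H'.
have HB := has_sumB H H'.
have {}HB := has_sum_S HB ltac:(by rewrite /eul !expr0 subrr).
have HZ := has_sumZ (- x) H'.
suff : s - s' = - x * s' by move=> E; rewrite -[s](subrK s') E; ring.
apply: (has_sum_unique HB); apply: (eq_has_sum HZ) => k /=.
have pk : 1 - p ^+ k.+1 != 0 by apply/norm_neq1/normXlt1.
have pp : qpoch p p k != 0 by exact: qpoch_neq0.
rewrite !eulE qpochS -exprS binS bin1 exprD !exprMn.
move: pk; rewrite !exprS.
move: (p ^+ 'C(k, 2)) ((-1) ^+ k) (x ^+ k) (p ^+ k) (qpoch p p k) pp.
by move=> a u y z d d0 pz; field; rewrite d0 pz.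
Qed.

(** Continuity of a power series at 0 along the points x p^n, by Tannery's theorem with the terms at
    x as dominating family. *)
Lemma power_sum_cvg (c : nat -> C) p x (s : nat -> C) : `|p| < 1 ->
  asum (fun m => c m * x ^+ m) ->
  (forall n, has_sum (fun m => c m * (x * p ^+ n) ^+ m) (s n)) ->
  s @ \oo --> c 0%N.
Proof.
move=> p1 ac Hs.
pose f0 (m : nat) : C := if m == 0%N then c 0%N else 0.
have f0s : has_sum f0 (c 0%N) by exact: has_sum1.
have T := @tannery R _ (fun n m => c m * (x * p ^+ n) ^+ m) f0 s (c 0%N) _ ac.
apply: T => [||n||].
- move=> n m; rewrite nrE lecR /= !nrM ler_wpM2l ?nr_ge0 //.
  rewrite !nrX lerXn2r ?nnegrE ?nr_ge0 //.
  rewrite nrM ler_piMr ?nr_ge0 // nrX exprn_ile1 ?nr_ge0 //.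
  by rewrite ltW // nr_lt1.
- move=> m; rewrite /f0 /=; case: eqP => [->|_].
    by rewrite expr0 mulr1 nrE.
  by rewrite normr0 -(rmorph0 (real_complex R)) lecR nr_ge0.
- exact: Hs.
- exact: f0s.
- move=> m; rewrite /f0; case: m => [|m] /=.
    have -> : (fun n => c 0%N * (x * p ^+ n) ^+ 0) = (fun=> c 0%N).
      by apply/funext => n; rewrite expr0 mulr1.
    exact: (cvg_cst (c 0%N)).
  rewrite -[X in _ --> X](mulr0 (c m.+1)).
  have -> : (fun n => c m.+1 * (x * p ^+ n) ^+ m.+1) =
     (fun n => c m.+1 * (x ^+ m.+1 * (p ^+ m.+1) ^+ n)).
    by apply/funext => n; rewrite exprMn -!exprM (mulnC n).
  by apply: cvgM; [exact: cvg_cst | apply/cvg_mulX/normXlt1].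
Qed.

Lemma eul_cvg1 p x (s : nat -> C) : `|p| < 1 ->
  (forall n, has_sum (eul p (x * p ^+ n)) (s n)) -> s @ \oo --> (1 : C).
Proof.
move=> p1 Hs.
have := @power_sum_cvg (fun m => p ^+ 'C(m, 2) * (-1) ^+ m / qpoch p p m) p x s p1.
rewrite !expr0 qpoch0 divr1 mulr1; apply.
  have := asum_eul x p1.
  by congr asum; apply/funext => m; rewrite eulE.
by move=> n; apply: (eq_has_sum (Hs n)) => m; rewrite eulE.
Qed.

Lemma eul_qpoch p x n s s' : `|p| < 1 ->
  has_sum (eul p x) s -> has_sum (eul p (x * p ^+ n)) s' ->
  s = qpoch x p n * s'.
Proof.
move=> p1; elim: n x s s' => [|n IH] x s s' H H'.
  by rewrite qpoch0 mul1r; apply: (has_sum_unique H); rewrite expr0 mulr1 in H'.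
have [s1 H1] := asum_has_sum (asum_eul (x * p) p1).
rewrite qpochSl -mulrA (has_sum_eul_shift p1 H H1); congr (_ * _).
by rewrite exprS mulrA in H'; exact: (IH _ _ _ H1 H').
Qed.

(** Iterating the shift gives s = (x;p)_n s_n, where s_n is Euler's series at x p^n and tends to 1;
    so (x;p)_n tends to s. This yields the convergence of the product and Euler's identity
    together. *)
Lemma qpoch_cvg_eul p x s : `|p| < 1 -> has_sum (eul p x) s ->
  qpoch x p @ \oo --> s.
Proof.
move=> p1 H.
have /choice[sn Hn] n : exists s, has_sum (eul p (x * p ^+ n)) s.
  by apply: asum_has_sum; exact: asum_eul.
have s1 := eul_cvg1 p1 Hn.
have E n : s = qpoch x p n * sn n := eul_qpoch p1 H (Hn n).
have : (fun n => s / sn n) @ \oo --> s / 1.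
  by apply: cvgM; [exact: cvg_cst | apply: cvgV => //; exact: oner_neq0].
rewrite divr1; apply: cvg_trans; apply: near_eq_cvg.
(* Dividing by [sn n] is legitimate only eventually: once it lies within distance 1 of its limit 1,
   it is nonzero. *)
have lt01 : 0 < 1 :> C by [].
have /cvgrPdist_lt/(_ 1 lt01)[N _ HN] := s1.
exists N => // n /HN /= lt1; rewrite {1}(E n) mulfK //.
by apply: contraTneq lt1 => ->; rewrite subr0 normr1 ltxx.
Qed.

Lemma euler_sum p x : `|p| < 1 -> has_sum (eul p x) (qpochinf x p).
Proof.
move=> p1; have [s Hs] := asum_has_sum (asum_eul x p1).
by rewrite /qpochinf (cvg_lim _ (qpoch_cvg_eul p1 Hs)).
Qed.

Lemma qpoch_cvg p x : `|p| < 1 -> qpoch x p @ \oo --> qpochinf x p.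
Proof. by move=> p1; apply: qpoch_cvg_eul => //; exact: euler_sum. Qed.

Lemma qpochinf_cut p x n : `|p| < 1 ->
  qpochinf x p = qpoch x p n * qpochinf (x * p ^+ n) p.
Proof. by move=> p1; apply: eul_qpoch => //; exact: euler_sum. Qed.

Lemma qpochinfS p x : `|p| < 1 ->
  qpochinf x p = (1 - x) * qpochinf (x * p) p.
Proof.
by move=> p1; apply: (has_sum_eul_shift p1); exact: euler_sum.
Qed.

Lemma qpochinf1 p : `|p| < 1 -> qpochinf 1 p = 0.
Proof. by move=> p1; rewrite qpochinfS // subrr mul0r. Qed.

(** Let s_n be the series at y p^n. Comparing terms gives (1 - y p^n) s_n = s_(n+1), so (y;p)_n s_0
    = s_n, which tends to 1. Stated as a product equal to 1, the result also shows that (y;p)_oo is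
    nonzero. *)
Lemma cauchy_sum p y : `|p| < 1 -> `|y| < 1 ->
  exists2 s, has_sum (cau p y) s & qpochinf y p * s = 1.
Proof.
move=> p1 y1.
have yn n : `|y * p ^+ n| < 1 by exact: normMXlt1.
have /choice[sn Hn] n : exists s, has_sum (cau p (y * p ^+ n)) s.
  by apply: asum_has_sum; exact: asum_cau.
have step n : (1 - y * p ^+ n) * sn n = sn n.+1.
  have HB := has_sumB (Hn n) (Hn n.+1).
  have {}HB := has_sum_S HB ltac:(by rewrite /cau !expr0 subrr).
  have HZ := has_sumZ (y * p ^+ n) (Hn n).
  suff : sn n - sn n.+1 = y * p ^+ n * sn n.
    by move=> E; rewrite mulrBl mul1r -E; ring.
  apply: (has_sum_unique HB); apply: (eq_has_sum HZ) => k /=.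
  have pk : 1 - p ^+ k.+1 != 0 by apply/norm_neq1/normXlt1.
  have pp : qpoch p p k != 0 by exact: qpoch_neq0.
  rewrite /cau qpochS -exprS.
  have -> : y * p ^+ n.+1 = y * p ^+ n * p by rewrite exprS; ring.
  move: (y * p ^+ n) => Y; rewrite exprMn; move: pk; rewrite !exprS.
  move: (Y ^+ k) (p ^+ k) (qpoch p p k) pp => u z d d0 pz.
  by field; rewrite d0 pz.
have cn n : qpoch y p n * sn 0%N = sn n.
  elim: n => [|n IH]; first by rewrite qpoch0 mul1r.
  by rewrite qpochS -mulrA mulrCA IH step.
have H0 := Hn 0%N; rewrite expr0 mulr1 in H0; exists (sn 0%N) => //.
have c1 : (fun n => qpoch y p n * sn 0%N) @ \oo --> qpochinf y p * sn 0%N.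
  by apply: cvgM; [exact: qpoch_cvg | exact: cvg_cst].
have c2 : (fun n => qpoch y p n * sn 0%N) @ \oo --> (1 : C).
  rewrite (_ : (fun n => _) = sn); last by apply/funext => n; rewrite cn.
  have := @power_sum_cvg (fun m => (qpoch p p m)^-1) p y sn p1.
  rewrite qpoch0 invr1; apply.
    have := asum_cau p1 y1.
    by congr asum; apply/funext => m; rewrite cauE.
  by move=> n; apply: (eq_has_sum (Hn n)) => m; rewrite cauE.
exact: (cvg_unique _ c1 c2).
Qed.

Lemma qpochinf_neq0 p x : `|p| < 1 -> `|x| < 1 -> qpochinf x p != 0.
Proof.
move=> p1 x1; have [s _ E] := cauchy_sum p1 x1.
by apply: contra_eq_neq E => ->; rewrite mul0r eq_sym oner_neq0.
Qed.

End InfiniteProducts.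

(** * The cubic sum *)

Section SequenceLimits.
Variable R : realType.
Local Notation C := (R[i] : numFieldType).
Implicit Types f g : nat -> C.

Definition seqlim f (l : C) := f @ \oo --> l.

Lemma seqlim_cst (c : C) : seqlim (fun=> c) c. Proof. exact: cvg_cst. Qed.

Lemma seqlimM f g l m : seqlim f l -> seqlim g m ->
  seqlim (fun n => f n * g n) (l * m).
Proof. exact: cvgM. Qed.

Lemma seqlimB f g l m : seqlim f l -> seqlim g m ->
  seqlim (fun n => f n - g n) (l - m).
Proof. exact: cvgB. Qed.

Lemma seqlimV f l : l != 0 -> seqlim f l -> seqlim (fun n => (f n)^-1) l^-1.
Proof. by move=> l0 fl; exact: cvgV. Qed.

Lemma seqlim_unique f l m : seqlim f l -> seqlim f m -> l = m.
Proof. by move=> fl fm; exact: (cvg_unique _ fl fm). Qed.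

Lemma eq_seqlim f g l : seqlim f l -> f =1 g -> seqlim g l.
Proof. by move=> fl fg; rewrite (_ : g = f) //; apply/funext => n; rewrite fg. Qed.

Lemma seqlim_mulnr f l d : seqlim f l -> seqlim (fun n => f (n * d.+1)%N) l.
Proof.
move=> fl; apply: (@cvg_comp _ _ _ (muln^~ d.+1) f _ _ _ _ fl).
exact: cvg_mulnr.
Qed.

Lemma seqlim_term0 f s : has_sum f s -> seqlim f 0.
Proof.
move=> /has_sum_series c; have c' := c; rewrite -cvg_shiftS in c'.
rewrite -(subrr s); apply: (eq_seqlim (seqlimB c' c)) => n /=.
by rewrite big_ord_recr /= addrAC subrr add0r.
Qed.

End SequenceLimits.
Arguments seqlim_cst {R} c.
Arguments seqlim_mulnr {R f l} d _.

(** * Splitting infinite products by residue classes *)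

Section ProductSplitting.
Variable R : realType.
Local Notation C := (R[i] : numFieldType).
Implicit Types p x : C.

Lemma seqlim_prod d (f : nat -> nat -> C) (l : nat -> C) :
  (forall r, seqlim (f r) (l r)) ->
  seqlim (fun n => \prod_(r < d) f r n) (\prod_(r < d) l r).
Proof.
move=> fl; elim: d => [|d IH].
  by rewrite big_ord0; apply: (eq_seqlim (seqlim_cst (1 : C))) => n; rewrite big_ord0.
rewrite big_ord_recr /=; apply: (eq_seqlim (seqlimM IH (fl d))) => n.
by rewrite big_ord_recr.
Qed.

Lemma qpochD x p m n : qpoch x p (m + n) = qpoch x p m * qpoch (x * p ^+ m) p n.
Proof.
rewrite /qpoch big_split_ord /=; congr (_ * _).
by apply: eq_bigr => i _; rewrite exprD mulrA.
Qed.

(** The factors are grouped by the residue of their index modulo [d]. *)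
Lemma qpoch_split d x p n :
  qpoch x p (n * d) = \prod_(r < d) qpoch (x * p ^+ r) (p ^+ d) n.
Proof.
elim: n => [|n IH]; first by rewrite mul0n qpoch0 big1 // => r _; rewrite qpoch0.
rewrite mulSn addnC qpochD IH -big_split /=; apply: eq_bigr => r _.
by rewrite qpochS -!exprM [(n * d)%N]mulnC mulrAC.
Qed.

Lemma qpochinf_split d x p : `|p| < 1 ->
  qpochinf x p = \prod_(r < d.+1) qpochinf (x * p ^+ r) (p ^+ d.+1).
Proof.
move=> p1; have pd : `|p ^+ d.+1| < 1 by exact: normXlt1.
have c1 := seqlim_mulnr d (qpoch_cvg (x := x) p1).
apply: (seqlim_unique c1).
have := @seqlim_prod d.+1 (fun r => qpoch (x * p ^+ r) (p ^+ d.+1)) _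
  (fun r => qpoch_cvg (x := x * p ^+ r) pd).
by move/eq_seqlim; apply => n; rewrite qpoch_split.
Qed.

Lemma qpochinf_split2 x p : `|p| < 1 ->
  qpochinf x p = qpochinf x (p ^+ 2) * qpochinf (x * p) (p ^+ 2).
Proof.
by move=> /(@qpochinf_split 1 x) ->; rewrite !big_ord_recr big_ord0 /= mul1r expr0 mulr1.
Qed.

Lemma qpochinf_split3 x p : `|p| < 1 -> qpochinf x p =
  qpochinf x (p ^+ 3) * qpochinf (x * p) (p ^+ 3) * qpochinf (x * p ^+ 2) (p ^+ 3).
Proof.
by move=> /(@qpochinf_split 2 x) ->; rewrite !big_ord_recr big_ord0 /= mul1r expr0 mulr1.
Qed.

Lemma qpochinf_sqr x p : `|p| < 1 ->
  qpochinf x p * qpochinf (- x) p = qpochinf (x ^+ 2) (p ^+ 2).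
Proof.
move=> p1; have p2 : `|p ^+ 2| < 1 by exact: normXlt1.
have c1 := seqlimM (qpoch_cvg (x := x) p1) (qpoch_cvg (x := - x) p1).
apply: (seqlim_unique c1); apply: (eq_seqlim (qpoch_cvg (x := x ^+ 2) p2)) => n.
rewrite /qpoch -big_split; apply: eq_bigr => i _ /=.
by rewrite -exprM mulnC exprM; move: (p ^+ i) => z; ring.
Qed.

End ProductSplitting.

Section CubicSum.
Variable R : realType.
Local Notation C := (R[i] : numFieldType).
Variable q : C.
Hypothesis q1 : `|q| < 1.

(* The term of [g a]. *)
Definition kt (a : C) (n : nat) : C :=
  qpoch a q n * (\prod_(i < n) (q ^+ 2 ^+ i.+1 - a)) * q ^+ 'C(n.+1, 2)
  / (qpoch (q ^+ 3) (q ^+ 3) n * qpoch (a ^+ 2 * q) (q ^+ 2) n).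

Lemma kt0 (a : C) : kt a 0 = 1.
Proof.
by rewrite /kt !qpoch0 big_ord0 (_ : 'C(1, 2) = 0%N) // expr0 !mulr1 divr1.
Qed.

Lemma ktS (a : C) n : kt a n.+1 = kt a n *
  ((1 - a * q ^+ n) * (q ^+ 2 ^+ n.+1 - a) * q ^+ n.+1 /
   ((1 - q ^+ 3 ^+ n.+1) * (1 - a ^+ 2 * q * q ^+ 2 ^+ n))).
Proof.
rewrite /kt !qpochS big_ord_recr /= -exprS [in 'C(n.+2, 2)]binS bin1 exprD.
rewrite !invfM.
set A := qpoch a q n; set B := \prod_(i < n) _; set D := q ^+ 'C(n.+1, 2).
set E := (qpoch (q ^+ 3) _ n)^-1; set F := (qpoch (a ^+ 2 * q) _ n)^-1.
by ring.
Qed.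

Lemma normX1 n : `|q ^+ n.+1| < 1. Proof. exact: normXlt1. Qed.

Lemma cube_neq n : 1 - q ^+ 3 ^+ n.+1 != 0.
Proof. by apply: norm_neq1; apply: normXlt1; exact: normX1. Qed.

Lemma sqr_neq (a : C) n : `|a| <= 1 -> 1 - a ^+ 2 * q * q ^+ 2 ^+ n != 0.
Proof.
move=> a1; apply: norm_neq1; rewrite -mulrA normrM.
apply: (@le_lt_trans _ _ `|q * q ^+ 2 ^+ n|).
  by rewrite ler_piMl // normrX exprn_ile1.
by apply: normMXlt1 => //; exact: normX1.
Qed.

(* WZ certificate: the telescoping companion of [kt a]. *)
Definition ktcert (a : C) (n : nat) : C :=
  kt a n * (1 - q ^+ n ^+ 3) * (1 - a ^+ 2 * q) * (1 - a ^+ 2 * q ^+ 3) *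
  (a * (1 - a * q * q ^+ n)) /
  ((q ^+ n ^+ 2 - a) * (1 - a ^+ 2 * q * q ^+ n ^+ 2)).

Lemma qX3S n : q ^+ 3 ^+ n.+1 = q ^+ 3 * q ^+ n ^+ 3.
Proof. by rewrite -!exprM -exprD; congr (q ^+ _); lia. Qed.

Lemma qX2S n : q ^+ 2 ^+ n.+1 = q ^+ 2 * q ^+ n ^+ 2.
Proof. by rewrite -!exprM -exprD; congr (q ^+ _); lia. Qed.

Lemma qX2 n : q ^+ 2 ^+ n = q ^+ n ^+ 2.
Proof. by rewrite -!exprM mulnC. Qed.

(** Replacing a by a q^2 moves every product in the term by whole steps, so the ratio of the two
    terms is rational in q^n. The factor 1 - a lost by (a;q)_n cancels the one gained by the product
    of the q^(2i) - a; only 1 - a q has to be cleared. *)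
Lemma kt_shift (a : C) n : `|a| <= 1 -> 1 - a * q != 0 ->
  (forall n, q ^+ n ^+ 2 - a != 0) ->
  kt (a * q ^+ 2) n * (1 - a * q) =
  kt a n * ((1 - a ^+ 2 * q) * (1 - a ^+ 2 * q ^+ 3) * q ^+ n ^+ 2 *
    (1 - a * q ^+ n) * (1 - a * q * q ^+ n) /
    ((q ^+ n ^+ 2 - a) * (1 - a ^+ 2 * q * q ^+ n ^+ 2) *
     (1 - a ^+ 2 * q ^+ 3 * q ^+ n ^+ 2))).
Proof.
move=> a1 aq0 H.
have s0 k : 1 - a ^+ 2 * q * q ^+ k ^+ 2 != 0.
  by rewrite -qX2; exact: sqr_neq.
have s1 k : 1 - a ^+ 2 * q ^+ 3 * q ^+ k ^+ 2 != 0.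
  have := s0 k.+1; rewrite [q ^+ k.+1]exprS; congr (_ != _); ring.
elim: n => [|n IH].
  have := H 0%N; have := s0 0%N; have := s1 0%N.
  by rewrite !kt0 !expr0 !expr1n !mulr1 => h1 h2 h3; field; rewrite h1 h2 h3.
rewrite !ktS mulrAC IH -[LHS]mulrA -[RHS]mulrA; congr (_ * _).
have c0 : 1 - q ^+ 3 * q ^+ n ^+ 3 != 0.
  by rewrite -qX3S cube_neq.
have := H n; have := H n.+1; have := s0 n; have := s0 n.+1; have := s1 n.
have := s1 n.+1.
rewrite qX3S qX2S qX2.
move: c0; rewrite ![q ^+ n.+1]exprS; move: (q ^+ n) => z c0 h1 h2 h3 h4 h5 h6.
have h7 : 1 - (a * q ^+ 2) ^+ 2 * q * z ^+ 2 != 0.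
  by move: h1; congr (_ != _); ring.
field; rewrite ?c0 ?h1 ?h2 ?h3 ?h4 ?h5 ?h6 ?h7 ?exprMn ?c0 //=.
Qed.

(** The certificate vanishes at n = 0 through its factor 1 - q^(3n). After [kt_shift], the induction
    step is an identity of rational functions in a, q and z = q^n. *)
Lemma kt_telescope (a : C) n : `|a| <= 1 -> 1 - a * q != 0 ->
  (forall n, q ^+ n ^+ 2 - a != 0) ->
  \sum_(k < n) ((1 - a ^+ 2 * q) * (1 - a ^+ 2 * q ^+ 3) * kt a k -
    (1 - a * q) * (1 - a ^+ 3 * q ^+ 3) * kt (a * q ^+ 2) k) = ktcert a n.
Proof.
move=> a1 aq0 H.
have s0 k : 1 - a ^+ 2 * q * q ^+ k ^+ 2 != 0.
  by rewrite -qX2; exact: sqr_neq.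
have s1 k : 1 - a ^+ 2 * q ^+ 3 * q ^+ k ^+ 2 != 0.
  have := s0 k.+1; rewrite [q ^+ k.+1]exprS; congr (_ != _); ring.
elim: n => [|n IH]; first by rewrite big_ord0 /ktcert expr0 expr1n subrr !(mulr0, mul0r).
rewrite big_ord_recr /= IH /ktcert ktS.
have -> : (1 - a * q) * (1 - a ^+ 3 * q ^+ 3) * kt (a * q ^+ 2) n =
   (1 - a ^+ 3 * q ^+ 3) * (kt (a * q ^+ 2) n * (1 - a * q)) by ring.
rewrite kt_shift //.
have c0 : 1 - q ^+ 3 * q ^+ n ^+ 3 != 0.
  by rewrite -qX3S cube_neq.
have := H n; have := H n.+1; have := s0 n; have := s0 n.+1; have := s1 n.
rewrite qX3S qX2S qX2.
move: c0 (kt a n); rewrite ![q ^+ n.+1]exprS; move: (q ^+ n) => z c0 T h1 h2 h3 h4 h5.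
field; rewrite ?c0 ?h1 ?h2 ?h3 ?h4 ?h5 ?exprMn ?c0 //=.
Qed.

(** A majorant of [kt a] uniform in |a| <= 1. The 4 bounds the two numerator factors of [ktS] that
    involve a, each at most 2 in modulus; each denominator factor is at least 1 - |q| in modulus. *)
Definition ktbd (n : nat) : R := \prod_(i < n) (4 * nr q ^+ i.+1 / (1 - nr q) ^+ 2).

Lemma bdd_ktbd : bdd_sums ktbd.
Proof.
have q0 := nr_ge0 q; have q1' : nr q < 1 by rewrite nr_lt1.
have q01 : 0 <= nr q < 1 by rewrite q0.
have d0 : 0 < (1 - nr q) ^+ 2 by rewrite exprn_gt0 // subr_gt0.
have e0 : 0 < (1 - nr q) ^+ 2 / 8 by rewrite divr_gt0.
have [N HN] := expr_small q01 e0.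
have bd0 n : 0 <= ktbd n.
  by apply: prodr_ge0 => i _; rewrite divr_ge0 ?mulr_ge0 ?exprn_ge0 ?subr_ge0 ?(ltW q1').
have h2 : 0 < (2^-1 : R) < 1 by rewrite invr_gt0 ltr0n /= invf_lt1 ?ltr1n ?ltr0n.
apply: (@bdd_sums_ratio R ktbd 2^-1 N bd0 h2) => n Nn.
rewrite /ktbd big_ord_recr /= -/(ktbd n) mulrC ler_wpM2r //.
rewrite ler_pdivrMr //; have := HN n.+1 (leqW Nn).
by rewrite ler_pdivlMr //; lra.
Qed.

Lemma kt_bound (a : C) n : `|a| <= 1 -> nr (kt a n) <= ktbd n.
Proof.
move=> a1; have q1' : nr q < 1 by rewrite nr_lt1.
have na1 : nr a <= 1 by move: a1; rewrite nrE -(rmorph1 (real_complex R)) lecR.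
have q0 := nr_ge0 q; have a0 := nr_ge0 a.
have d0 : 0 < 1 - nr q by rewrite subr_gt0.
elim: n => [|n IH]; first by rewrite kt0 nr1 /ktbd big_ord0.
rewrite ktS nrM /ktbd big_ord_recr /= ler_pM ?nr_ge0 //.
rewrite !nrM nrV nrM invfM expr2 invfM.
have b1 : nr (1 - a * q ^+ n) <= 2.
  apply: le_trans (nr_leB _ _) _; rewrite nr1 nrM nrX.
  have : nr a * nr q ^+ n <= 1 by rewrite mulr_ile1 ?exprn_ge0 // exprn_ile1 // ltW.
  by lra.
have b2 : nr (q ^+ 2 ^+ n.+1 - a) <= 2.
  apply: le_trans (nr_leB _ _) _; rewrite !nrX -exprM.
  have : nr q ^+ (2 * n.+1) <= 1 by rewrite exprn_ile1 // ltW.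
  by lra.
have b3 : (nr (1 - q ^+ 3 ^+ n.+1))^-1 <= (1 - nr q)^-1.
  rewrite lef_pV2 ?posrE //.
    by rewrite -exprM (_ : (3 * n.+1)%N = (3 * n.+1).-1.+1) //; exact: nr1B.
  by rewrite nr_gt0 cube_neq.
have b4 : (nr (1 - a ^+ 2 * q * q ^+ 2 ^+ n))^-1 <= (1 - nr q)^-1.
  rewrite lef_pV2 ?posrE //; last by rewrite nr_gt0 sqr_neq.
  apply: le_trans (nr_geB _ _); rewrite nr1 lerD2l lerN2 -mulrA nrM nrX.
  apply: (@le_trans _ _ (1 * nr (q * q ^+ 2 ^+ n))).
    by rewrite ler_wpM2r ?nr_ge0 // exprn_ile1.
  by rewrite mul1r nrM ler_piMr // !nrX -exprM exprn_ile1 // ltW.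
have b12 : nr (1 - a * q ^+ n) * nr (q ^+ 2 ^+ n.+1 - a) <= 4.
  by apply: le_trans (ler_pM (nr_ge0 _) (nr_ge0 _) b1 b2) _; lra.
apply: ler_pM; rewrite ?mulr_ge0 ?invr_ge0 ?nr_ge0 //.
  by rewrite nrX ler_wpM2r ?exprn_ge0.
by apply: ler_pM; rewrite ?invr_ge0 ?nr_ge0.
Qed.

Lemma asum_kt (a : C) : `|a| <= 1 -> asum (kt a).
Proof.
by move=> a1; apply: (le_bdd_sums bdd_ktbd) => n; rewrite /= nr_ge0 kt_bound.
Qed.

(** At a = 0 the powers of q collect into Q^C(n+1,2) with Q = q^3, leaving Euler's term for
    (-Q;Q)_oo. This gives the limit value of g(a q^(2i)). *)
Lemma kt_zero n : kt 0 n = eul (q ^+ 3) (- (q ^+ 3)) n.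
Proof.
elim: n => [|n IH]; first by rewrite kt0 /eul !expr0 qpoch0 invr1 !mulr1.
rewrite ktS IH (expr0n _ 2) /= !mul0r !subr0 mul1r mulr1.
have -> : q ^+ 2 ^+ n.+1 * q ^+ n.+1 = q ^+ 3 ^+ n.+1.
  by rewrite -!exprM -!exprD; congr (q ^+ _); lia.
rewrite /eul opprK qpochS -[q ^+ 3 * _ ^+ n]exprS binS bin1 exprD invfM.
move: (qpoch _ _ n)^-1 (1 - _)^-1 => u v; rewrite [q ^+ 3 ^+ n.+1]exprS.
by move: (q ^+ 3 ^+ n) (q ^+ 3 ^+ 'C(n, 2)) => y z; ring.
Qed.

Lemma seqlim_geom k : seqlim (fun n => q ^+ n ^+ k.+1) 0.
Proof.
apply: (eq_seqlim (cvg_expr0 (normX1 k))) => n.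
by rewrite -!exprM mulnC.
Qed.

(** The factor [kt a n] tends to 0 as the term of a convergent sum, while the other factors have
    finite limits; [a != 0] keeps the limit -a of q^(2n) - a invertible. *)
Lemma ktcert_cvg (a s : C) : a != 0 -> `|a| <= 1 -> has_sum (kt a) s ->
  seqlim (ktcert a) 0.
Proof.
move=> a0 a1 Hs.
have k0 := seqlim_term0 Hs.
pose c := (1 - a ^+ 2 * q) * (1 - a ^+ 2 * q ^+ 3).
have cc (x : C) := seqlim_cst x.
have g2 := seqlim_geom 1; have g3 := seqlim_geom 2.
have g1 : seqlim (fun n => q ^+ n) 0 := cvg_expr0 q1.
have d1 := seqlimB (cc 1) (seqlimM (cc (a ^+ 2 * q)) g2).
have d2 := seqlimM (seqlimB g2 (cc a)) d1.
have d0 : (0 - a) * (1 - a ^+ 2 * q * 0) != 0.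
  by rewrite mulr0 subr0 mulr1 sub0r oppr_eq0.
have d3 := seqlimV d0 d2.
have d4 := seqlimM (cc a) (seqlimB (cc 1) (seqlimM (cc (a * q)) g1)).
have := seqlimM k0 (seqlimM (seqlimM (seqlimM (seqlimB (cc 1) g3) (cc c)) d4) d3).
rewrite mul0r => /eq_seqlim; apply => n; rewrite /ktcert /c.
by move: (_^-1) => D; ring.
Qed.

Lemma kt_sum_step (a s s' : C) : a != 0 -> `|a| <= 1 -> 1 - a * q != 0 ->
  (forall n, q ^+ n ^+ 2 - a != 0) ->
  has_sum (kt a) s -> has_sum (kt (a * q ^+ 2)) s' ->
  (1 - a ^+ 2 * q) * (1 - a ^+ 2 * q ^+ 3) * s =
  (1 - a * q) * (1 - a ^+ 3 * q ^+ 3) * s'.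
Proof.
move=> a0 a1 aq0 H Hs Hs'; apply/eqP; rewrite -subr_eq0; apply/eqP.
have /has_sum_series := has_sumB
  (has_sumZ ((1 - a ^+ 2 * q) * (1 - a ^+ 2 * q ^+ 3)) Hs)
  (has_sumZ ((1 - a * q) * (1 - a ^+ 3 * q ^+ 3)) Hs').
move=> c1; apply: (seqlim_unique c1).
apply: (eq_seqlim (ktcert_cvg a0 a1 Hs)) => n.
by rewrite kt_telescope.
Qed.

Lemma kt_cvg_zero (u : nat -> C) n :
  seqlim u 0 -> seqlim (fun i => kt (u i) n) (kt 0 n).
Proof.
move=> u0; elim: n => [|n IH].
  by rewrite kt0; apply: (eq_seqlim (seqlim_cst (1 : C))) => i; rewrite kt0.
have cc (x : C) := seqlim_cst x.
have d1 := seqlimM (seqlimM (seqlimM u0 u0) (cc q)) (cc (q ^+ 2 ^+ n)).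
have d2 := seqlimM (cc (1 - q ^+ 3 ^+ n.+1)) (seqlimB (cc 1) d1).
have dn0 : (1 - q ^+ 3 ^+ n.+1) * (1 - 0 * 0 * q * q ^+ 2 ^+ n) != 0.
  by rewrite !mul0r subr0 mulr1 cube_neq.
have d3 := seqlimV dn0 d2.
have d4 := seqlimB (cc 1) (seqlimM u0 (cc (q ^+ n))).
have d5 := seqlimB (cc (q ^+ 2 ^+ n.+1)) u0.
rewrite ktS expr2.
have := seqlimM IH (seqlimM (seqlimM (seqlimM d4 d5) (cc (q ^+ n.+1))) d3).
by move/eq_seqlim; apply => i; rewrite ktS expr2.
Qed.

(** The functional equation is iterated along u_i = a q^(2i), which tends to 0; the hypothesis on
    q^(2n) - a q^(2m) allows it at every u_i. Tannery's theorem with the uniform majorant [ktbd]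
    evaluates the limit at a = 0. *)
Lemma kt_sum (a s : C) : q != 0 -> a != 0 -> `|a| <= 1 ->
  (forall m n, q ^+ n ^+ 2 - a * q ^+ 2 ^+ m != 0) -> has_sum (kt a) s ->
  s * qpochinf (a ^+ 2 * q) (q ^+ 2) =
  qpochinf (a * q) (q ^+ 2) * qpochinf (a ^+ 3 * q ^+ 3) (q ^+ 6) *
  qpochinf (- q ^+ 3) (q ^+ 3).
Proof.
move=> q0 a0 a1 H Hs; pose u i : C := a * q ^+ 2 ^+ i.
have q2 : `|q ^+ 2| < 1 by exact: normX1.
have q3 : `|q ^+ 3| < 1 by exact: normX1.
have q4 : `|q ^+ 4| < 1 by exact: normX1.
have q6 : `|q ^+ 6| < 1 by exact: normX1.
have u0 i : u i != 0 by rewrite mulf_neq0 ?expf_neq0.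
have u1 i : `|u i| <= 1 by rewrite normrM mulr_ile1 // normrX exprn_ile1 // ltW.
have uq i : 1 - u i * q != 0.
  apply: norm_neq1; rewrite normrM; apply: le_lt_trans q1.
  by rewrite ler_piMl // u1.
have /choice[sn Hn] i : exists s, has_sum (kt (u i)) s.
  by apply: asum_has_sum; exact: asum_kt.
have step i : (1 - u i ^+ 2 * q) * (1 - u i ^+ 2 * q ^+ 3) * sn i =
  (1 - u i * q) * (1 - u i ^+ 3 * q ^+ 3) * sn i.+1.
  apply: (kt_sum_step (u0 i) (u1 i) (uq i) (H i) (Hn i)).
  by have := Hn i.+1; rewrite /u exprSr mulrA.
(* Each step multiplies a by q^2, hence a^2 by q^4 and a^3 by q^6, whence the bases. The two
   products to base q^4 later recombine into (a^2 q;q^2)_oo. *)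
have E i : sn 0%N * (qpoch (a ^+ 2 * q) (q ^+ 4) i * qpoch (a ^+ 2 * q * q ^+ 2) (q ^+ 4) i) =
  qpoch (a * q) (q ^+ 2) i * qpoch (a ^+ 3 * q ^+ 3) (q ^+ 6) i * sn i.
  elim: i => [|i IH]; first by rewrite !qpoch0 !mulr1 mul1r.
  rewrite !qpochS.
  have e4 : q ^+ 4 ^+ i = q ^+ 2 ^+ i ^+ 2.
    by rewrite -!exprM; congr (q ^+ _); lia.
  have e6 : q ^+ 6 ^+ i = q ^+ 2 ^+ i ^+ 3.
    by rewrite -!exprM; congr (q ^+ _); lia.
  have {step} := step i; rewrite /u e4 e6.
  move: (q ^+ 2 ^+ i) IH => z IH st.
  transitivity ((1 - (a * z) ^+ 2 * q) * (1 - (a * z) ^+ 2 * q ^+ 3) *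
     (sn 0%N * (qpoch (a ^+ 2 * q) (q ^+ 4) i * qpoch (a ^+ 2 * q * q ^+ 2) (q ^+ 4) i))).
    by ring.
  rewrite IH mulrCA st.
  by move: (qpoch _ _ i) (qpoch _ _ i) => X Y; ring.
have S0 : sn 0%N = s.
  apply: (has_sum_unique _ Hs); move: (Hn 0%N).
  by rewrite /u expr0 mulr1.
have uc : u @ \oo --> (0 : C) by exact: cvg_mulX.
have E3 : has_sum (eul (q ^+ 3) (- q ^+ 3)) (qpochinf (- q ^+ 3) (q ^+ 3)).
  exact: euler_sum.
have kc n := @kt_cvg_zero u n uc.
have sc : sn @ \oo --> qpochinf (- q ^+ 3) (q ^+ 3).
  apply: (@tannery R _ (fun i => kt (u i)) (kt 0) sn _ _ bdd_ktbd).
  - by move=> i n; rewrite nrE lecR kt_bound.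
  - by move=> n; rewrite nrE lecR kt_bound // normr0.
  - exact: Hn.
  - by apply: (eq_has_sum E3) => n; rewrite kt_zero.
  - exact: kc.
rewrite (qpochinf_split2 (a ^+ 2 * q) q2) -exprM -[(2 * 2)%N]/4%N.
have c1 := seqlimM (seqlim_cst s) (seqlimM (qpoch_cvg (x := a ^+ 2 * q) q4)
  (qpoch_cvg (x := a ^+ 2 * q * q ^+ 2) q4)).
have c2 := seqlimM (seqlimM (qpoch_cvg (x := a * q) q2)
  (qpoch_cvg (x := a ^+ 3 * q ^+ 3) q6)) sc.
apply: (seqlim_unique c1); apply: (eq_seqlim c2) => i.
by rewrite -E S0.
Qed.

End CubicSum.

(** * The cubic sum at a cube root of q *)

Section CubeRoot.
Variable R : realType.
Local Notation C := (R[i] : numFieldType).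
Variables t q : C.
Hypotheses (t0 : t != 0) (tq : t ^+ 3 = q) (q1 : `|q| < 1).

Definition ft (n : nat) : C :=
  qpoch t q n * (- (t * q)) ^+ n * q ^+ 'C(n, 2) / qpoch (q ^+ 3) (q ^+ 3) n.

Lemma root_lt1 : `|t| < 1.
Proof.
by rewrite -(@expr_lt1 _ 3) ?normr_ge0 // -normrX tq.
Qed.

(** Since q = t^3, one has q^(2i) - t = -t (1 - t^2 q^(2i-1)), so the product in the numerator
    cancels (t^2 q;q^2)_n. *)
Lemma kt_root n : kt q t n = ft n.
Proof.
elim: n => [|n IH]; first by rewrite kt0 /ft !expr0 !qpoch0 !mulr1 divr1.
rewrite ktS // IH /ft !qpochS binS bin1 exprD -[q ^+ 3 * _ ^+ n]exprS.
have s0 : 1 - t ^+ 2 * q * q ^+ 2 ^+ n != 0.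
  by apply: sqr_neq => //; rewrite ltW // root_lt1.
have c0 := cube_neq q1 n.
have p0 : qpoch (q ^+ 3) (q ^+ 3) n != 0.
  by apply: qpoch_neq0; exact: normX1.
have -> : q ^+ 2 ^+ n.+1 - t = - t * (1 - t ^+ 2 * q * q ^+ 2 ^+ n).
  transitivity (q * (t ^+ 3 * q ^+ 2 ^+ n) - t); last by ring.
  by rewrite tq [q ^+ 2 ^+ _]exprS; ring.
move: s0 c0 p0; rewrite [q ^+ n.+1]exprS [_ ^+ n.+1 in RHS]exprS.
move: (1 - t ^+ 2 * _ * _) (1 - q ^+ 3 ^+ n.+1) => A B.
move: (qpoch (q ^+ 3) _ n) (qpoch t _ n) => D E A0 B0 D0.
by field; rewrite A0 B0 D0.
Qed.

Lemma ft_sum s : has_sum ft s ->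
  s * qpochinf (t ^+ 2) q =
  qpochinf (t ^+ 2) (q ^+ 2) * qpochinf (t * q) (q ^+ 2) *
  qpochinf (q ^+ 4) (q ^+ 6) * qpochinf (- q ^+ 3) (q ^+ 3).
Proof.
move=> Hs; have t1 := root_lt1.
have q0 : q != 0 by rewrite -tq expf_neq0.
have Hk : has_sum (kt q t) s.
  by apply: (eq_has_sum Hs) => n; rewrite kt_root.
(* As powers of t the two terms have exponents 6n and 6m+1, which always differ, and distinct powers
   of t are distinct because 0 < |t| < 1. *)
have ne m n : q ^+ n ^+ 2 - t * q ^+ 2 ^+ m != 0.
  have tX a b : (a < b)%N -> t ^+ a != t ^+ b.
    move=> ab; rewrite -(subnKC (ltnW ab)) exprD -[X in X != _]mulr1.
    rewrite (inj_eq (mulfI _)) ?expf_neq0 // -subr_eq0.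
    rewrite (_ : (b - a)%N = (b - a).-1.+1); last by lia.
    by apply: norm_neq1; exact: normXlt1.
  rewrite subr_eq0 -tq -!exprM -exprS.
  have [|h|h] := ltngtP (3 * (n * 2)) (3 * (2 * m)).+1; last by lia.
    exact: tX.
  by rewrite eq_sym; exact: tX.
have := kt_sum q1 q0 t0 (ltW t1) ne Hk.
rewrite (qpochinf_split2 (t ^+ 2) q1) tq -[q * q ^+ 3]exprS => E.
by rewrite mulrCA E !mulrA.
Qed.

End CubeRoot.

(** * Jacobi's triple product *)

Section IntTheta.
Variable R : realType.
Local Notation C := (R[i] : numFieldType).
Implicit Types p x y : C.

(* n(n-1)/2, which is a natural number also for negative [n]. *)
Definition binz (n : int) : nat :=
  match n with Posz k => 'C(k, 2) | Negz k => 'C(k.+2, 2) end.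

Lemma bin2_mul2 k : (2 * 'C(k, 2) + k = k * k)%N.
Proof. by elim: k => // k IH; rewrite binS bin1; nia. Qed.

Lemma binz2 (n : int) : 2 * (binz n)%:Z = n * n - n.
Proof.
case: n => k /=; first by have := bin2_mul2 k; nia.
by have := bin2_mul2 k.+2; rewrite NegzE; nia.
Qed.

Definition th p x (n : int) : C := p ^+ binz n * x ^ n.

(** Polarization of n(n-1)/2: the cross term p^(mn) is what turns a shift of the summation index
    into a change of argument. *)
Lemma thD p x (m n : int) : p != 0 -> x != 0 ->
  th p x (m + n) = th p x m * th p x n * p ^ (m * n).
Proof.
move=> p0 x0; rewrite /th expfzDr // !exprnP.
have -> : (binz (m + n))%:Z = (binz m)%:Z + (binz n)%:Z + m * n.
  by have := binz2 (m + n); have := binz2 m; have := binz2 n; nia.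
rewrite !expfzDr //.
by move: (p ^ _) (p ^ _) (p ^ _) (x ^ _) (x ^ _) => a b c d e; ring.
Qed.

Lemma thM p x y (n : int) : th p (x * y) n = th p x n * y ^ n.
Proof. by rewrite /th expfzMl mulrA. Qed.

Lemma asum_gauss (f : nat -> C) c p : `|p| < 1 ->
  (forall n, f n.+1 = f n * (c * p ^+ n)) -> asum f.
Proof.
move=> p1 fS; have p0 := nr_ge0 p; have c0 := nr_ge0 c.
have p01 : 0 <= nr p < 1 by rewrite p0 nr_lt1.
have e0 : 0 < (2 * (nr c + 1))^-1 by rewrite invr_gt0 mulr_gt0 // ltr_wpDl.
have [N HN] := expr_small p01 e0.
apply: (@bdd_sums_ratio _ _ 2^-1 N) => [n||n Nn /=].
- exact: nr_ge0.
- by rewrite invr_gt0 ltr0n /= invf_lt1 ?ltr1n ?ltr0n.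
rewrite fS !nrM mulrC ler_wpM2r ?nr_ge0 // nrX.
apply: (@le_trans _ _ ((nr c + 1) * (2 * (nr c + 1))^-1)).
  by rewrite ler_pM ?exprn_ge0 ?lerDl // HN.
by rewrite invfM mulrCA divff ?mulr1 // gt_eqF // ltr_wpDl.
Qed.

Lemma asum_th p x : p != 0 -> x != 0 -> `|p| < 1 -> asum (th p x).
Proof.
move=> p0 x0 p1; apply: asum_int.
  apply: (@asum_gauss _ x p p1) => n.
  rewrite (_ : n.+1%:Z = n%:Z + 1); last by lia.
  rewrite thD // mulr1 -exprnP -mulrA; congr (_ * _).
  by rewrite /th /= expr0 mul1r expr1z.
(* The ratio of the term at -(n+2) to the term at -(n+1) is p^(n+2) / x. *)
apply: (@asum_gauss _ (p ^+ 2 / x) p p1) => n.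
rewrite (_ : Negz n.+1 = Negz n + (-1)); last by rewrite !NegzE; lia.
rewrite thD // -mulrA; congr (_ * _).
rewrite (_ : Negz n * -1 = n.+1%:Z); last by rewrite NegzE; lia.
rewrite -exprnP /th /= expr1 exprN1 exprS expr2.
by move: (p ^+ n) x^-1 => a b; ring.
Qed.

(** For negative m the product contains the factor 1 - p^0 and vanishes. This is how sums over all
    integers get cut down to natural indices. *)
Lemma qpochinf_expz p (m : int) : p != 0 -> `|p| < 1 ->
  qpochinf (p ^ (m + 1)) p =
  if m is Posz k then qpochinf p p / qpoch p p k else 0.
Proof.
move=> p0 p1; case: m => k.
  rewrite (qpochinf_cut p k p1) -exprS.
  rewrite (_ : k%:Z + 1 = k.+1%:Z); last by lia.
  by rewrite -exprnP mulrAC divff ?mul1r // qpoch_neq0.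
rewrite (qpochinf_cut _ k p1) exprnP -expfzDr //.
rewrite (_ : Negz k + 1 + k%:Z = 0); last by rewrite NegzE; lia.
by rewrite expr0z qpochinf1 // mulr0.
Qed.

Lemma has_sum_posz (f : int -> C) s :
  (forall k, f (Negz k) = 0) ->
  has_sum (fun k : nat => f k%:Z) s -> has_sum f s.
Proof.
move=> f0 fs.
have H1 j : ((absz j)%:Z != j) -> f j = 0 by case: j => // k; rewrite abszE eqxx.
by have [_] := has_sum_reindex s (phi := Posz) (psi := absz) (fun=> erefl) H1; apply.
Qed.

(** Multiply the theta series by Cauchy's series for 1/(p/x;p)_oo and sum along a fixed difference m
    of the two indices. The inner sum is Euler's series for (p^(m+1);p)_oo, which is 0 for m < 0;
    the terms with m >= 0 form (p;p)_oo times Euler's series for (x;p)_oo. *)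
Lemma jacobi_triple p x : p != 0 -> x != 0 -> `|p| < 1 -> `|p / x| < 1 ->
  has_sum (th p (- x)) (qpochinf p p * qpochinf x p * qpochinf (p / x) p).
Proof.
move=> p0 x0 p1 px1; have x0' : - x != 0 by rewrite oppr_eq0.
have ath := asum_th p0 x0' p1.
have [T HT] := asum_has_sum ath.
have [s Hs Es] := cauchy_sum p1 px1.
pose F (u : int * nat) := th p (- x) u.1 * cau p (p / x) u.2.
pose phi (u : int * nat) := (u.1 + u.2%:Z, u.2).
pose psi (u : int * nat) := (u.1 - u.2%:Z, u.2).
have phiK : cancel phi psi by case=> m r; rewrite /phi /psi /= addrK.
have psiK u : phi (psi u) != u -> F u = 0.
  by case: u => m r; rewrite /phi /psi /= subrK eqxx.
have HF : has_sum F (T * s) := has_sum_prod ath (asum_cau p1 px1) HT Hs.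
have [/(_ HF) Hf _] := has_sum_reindex (T * s) phiK psiK.
have rows m : has_sum (fun r => (F \o phi) (m, r))
    (th p (- x) m * qpochinf (p ^ (m + 1)) p).
  have e := euler_sum (x := p ^ (m + 1)) p1.
  apply: (eq_has_sum (has_sumZ (th p (- x) m) e)) => r.
  rewrite /F /= thD // -!mulrA; congr (_ * _).
  rewrite eulE /cau expfzDr // expr1z !exprMn exprVn /th /= -exprnP (exprNn x).
  rewrite [(p ^ m) ^+ r]exprnP exprz_exp.
  have : x ^+ r != 0 by rewrite expf_neq0.
  have : qpoch p p r != 0 by exact: qpoch_neq0.
  move: (qpoch _ _ _) (x ^+ r) (p ^+ r) (p ^ _) ((-1) ^+ r) (p ^+ 'C(r, 2)).
  by move=> A X P D E G A0 X0; field; rewrite A0 X0.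
have HG := has_sum_fubini Hf rows.
have HG' : has_sum (fun m => th p (- x) m * qpochinf (p ^ (m + 1)) p)
    (qpochinf p p * qpochinf x p).
  apply: has_sum_posz => [k|]; first by rewrite qpochinf_expz // mulr0.
  have e := euler_sum (x := x) p1.
  apply: (eq_has_sum (has_sumZ (qpochinf p p) e)) => k.
  rewrite qpochinf_expz // /eul /th /= -exprnP.
  by move: (_^-1) => D; ring.
rewrite -(has_sum_unique HG HG') -mulrA [s * _]mulrC Es mulr1; exact: HT.
Qed.

End IntTheta.

(** * The triple sum and its two evaluations *)

Section BoundedMultipliers.
Variable R : realType.
Local Notation C := (R[i] : numFieldType).
Implicit Types p : C.

Lemma asum_bounded (I : choiceType) (c g : I -> C) (M : R) :
  asum g -> (forall i, nr (c i) <= M) -> asum (fun i => c i * g i).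
Proof.
move=> ag cM; apply: (le_bdd_sums (bdd_sumsZ (normr_ge0 M) ag)) => i /=.
rewrite nr_ge0 nrM ler_wpM2r ?nr_ge0 //.
exact: le_trans (cM i) (ler_norm M).
Qed.

Lemma nr_sum_ord (f : nat -> C) n : nr (\sum_(i < n) f i) <= \sum_(i < n) nr (f i).
Proof.
elim: n => [|n IH]; first by rewrite !big_ord0 nr0.
by rewrite !big_ord_recr /=; apply: le_trans (nr_leD _ _) _; rewrite lerD2r.
Qed.

Lemma asum_partial_bound (f : nat -> C) : asum f ->
  exists M, forall n, nr (\sum_(i < n) f i) <= M.
Proof.
move=> [f0 [M HM]]; exists M => n; apply: le_trans (nr_sum_ord f n) _.
apply: le_trans (HM [fset i in iota 0 n]%fset).
rewrite -(big_mkord xpredT (fun i => nr (f i))) /index_iota subn0.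
rewrite le_eqVlt; apply/orP; left; apply/eqP/perm_big.
by apply: uniq_perm; rewrite ?iota_uniq ?fset_uniq // => i; rewrite !inE.
Qed.

(** A telescoping identity that bounds 1/(p;p)_n by partial sums of Cauchy's series at y = p. *)
Lemma inv_qpoch_sum p n : `|p| < 1 ->
  (qpoch p p n)^-1 = \sum_(j < n.+1) cau p p j.
Proof.
move=> p1; elim: n => [|n IH].
  by rewrite big_ord_recr big_ord0 /= /cau qpoch0 expr0 add0r divr1 invr1.
rewrite big_ord_recr /= -IH /cau qpochS -exprS.
have pn : 1 - p ^+ n.+1 != 0 by apply/norm_neq1/normXlt1.
have p0 : qpoch p p n != 0 by exact: qpoch_neq0.
move: (p ^+ n.+1) (qpoch p p n) pn p0 => z d z0 d0.
by field; rewrite z0 d0.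
Qed.

Lemma inv_qpoch_bound p : `|p| < 1 ->
  exists M, forall n, nr (qpoch p p n)^-1 <= M.
Proof.
move=> p1; have [M HM] := asum_partial_bound (asum_cau p1 p1).
by exists M => n; rewrite inv_qpoch_sum.
Qed.

End BoundedMultipliers.

Section Monomials.
Variable R : realType.
Local Notation C := (R[i] : numFieldType).
Variable t : C.
Hypothesis t0 : t != 0.

(* All exponent identities below are checked on signed powers of [t]. *)
Definition mono (a e : int) : C := (-1) ^ a * t ^ e.

Lemma N1_neq0 : (-1 : C) != 0. Proof. by rewrite oppr_eq0 oner_neq0. Qed.

Lemma monoM a e b f : mono a e * mono b f = mono (a + b) (e + f).
Proof.
rewrite /mono !expfzDr ?N1_neq0 //.
by move: ((-1) ^ a) ((-1) ^ b) (t ^ e) (t ^ f) => x y z u; ring.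
Qed.

Lemma monoX a e (n : int) : mono a e ^ n = mono (a * n) (e * n).
Proof. by rewrite /mono expfzMl !exprz_exp. Qed.

Lemma monoXn a e (n : nat) : mono a e ^+ n = mono (a * n) (e * n).
Proof. by rewrite exprnP monoX. Qed.

Lemma mono_sign a b e : mono (a + 2 * b) e = mono a e.
Proof.
by rewrite /mono expfzDr ?N1_neq0 // -exprz_exp -[(-1) ^ 2]exprnP sqrrN expr1n exp1rz mulr1.
Qed.

Lemma th_mono d a e (n : int) :
  th (mono 0 d) (mono a e) n = mono (a * n) (d * (binz n)%:Z + e * n).
Proof. by rewrite /th monoXn monoX monoM mul0r add0r. Qed.

Lemma mono_t e : mono 0 e = t ^ e. Proof. by rewrite /mono expr0z mul1r. Qed.

Lemma mono_N1 a : mono a 0 = (-1) ^ a. Proof. by rewrite /mono expr0z mulr1. Qed.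

Lemma mono_Nt e : mono 1 e = - t ^ e. Proof. by rewrite /mono expr1z mulN1r. Qed.

End Monomials.

(** * The triple sum with M = N + k fixed *)

Section CubeRootFamily.
Variable R : realType.
Local Notation C := (R[i] : numFieldType).
Variables t q : C.
Hypotheses (t0 : t != 0) (tq : t ^+ 3 = q) (q1 : `|q| < 1).
Local Notation Q := (q ^+ 3).

Definition cf (u : nat * nat) : C :=
  eul q (t ^+ 2 / q ^+ u.1) u.2 * (t ^- u.1 * q ^+ (u.1 * u.1 + u.1) / qpoch Q Q u.1).

(* The triple sum B_t at (N, m, k), indexed by u = (N + k, (k, m)). *)
Definition bt (u : int * (nat * nat)) : C := th q (- (q * t)) u.1 * cf u.2.

Let q0 : q != 0. Proof. by rewrite -tq expf_neq0. Qed.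
Let Q1 : `|Q| < 1. Proof. exact: normXlt1. Qed.

Lemma q_mono : q = mono t 0 3. Proof. by rewrite mono_t -tq. Qed.

Lemma qX_mono n : q ^+ n = mono t 0 (3 * n%:Z).
Proof. by rewrite q_mono monoXn mul0r. Qed.

Lemma th_q_mono a e n :
  th q (mono t a e) n = mono t (a * n) (3 * (binz n)%:Z + e * n).
Proof. by rewrite {1}q_mono th_mono. Qed.

Lemma qt_mono : - (q * t) = mono t 1 4.
Proof. by rewrite mono_Nt -tq -exprSr. Qed.

Lemma tq_mono : - (t * q) = mono t 1 4.
Proof. by rewrite mulrC qt_mono. Qed.

Lemma tV_mono n : t ^- n = mono t 0 (- n%:Z).
Proof. by rewrite mono_t exprnN. Qed.

Lemma sqr_mono n : t ^+ 2 / q ^+ n = mono t 0 (2 - 3 * n%:Z).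
Proof.
rewrite qX_mono mono_t -[(t ^ _)^-1]exprN1 exprz_exp exprnP -expfzDr // mono_t.
by congr (t ^ _); lia.
Qed.

(** In the variables m - k and k the exponent decouples, so [cf] is a product of two theta terms
    with bounded multipliers; its absolute summability follows. *)
Lemma cf_th u : cf u = (qpoch q q u.2)^-1 * (qpoch Q Q u.1)^-1 *
  (th q (- t ^+ 2) (u.2%:Z - u.1%:Z) * th q (- (t * q)) u.1%:Z).
Proof.
case: u => k m /=; rewrite /cf eulE /= sqr_mono tV_mono !qX_mono.
rewrite monoXn [(-1) ^+ m]exprnP -(mono_N1 t) tq_mono.
rewrite (_ : - t ^+ 2 = mono t 1 2); last by rewrite mono_Nt.
rewrite !th_q_mono.
have E : mono t 0 (3 * 'C(m, 2)%:Z) * mono t m 0 *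
   mono t (0 * m%:Z) ((2 - 3 * k%:Z) * m%:Z) *
   (mono t 0 (- k%:Z) * mono t 0 (3 * (k * k + k)%:Z)) =
   mono t (1 * (m%:Z - k%:Z)) (3 * (binz (m%:Z - k%:Z))%:Z + 2 * (m%:Z - k%:Z)) *
   mono t (1 * k%:Z) (3 * (binz k)%:Z + 4 * k%:Z).
  rewrite !monoM //; congr (mono t _ _); first by lia.
  have := binz2 (m%:Z - k%:Z); have := binz2 k; have := binz2 m.
  by rewrite /=; nia.
rewrite -E; move: (mono _ _ _) (mono _ _ _) => a b.
by move: (qpoch q q m)^-1 (qpoch Q Q k)^-1 (mono _ _ _) (mono _ _ _) (mono _ _ _) => c d e f g; ring.
Qed.

Lemma asum_cf : asum cf.
Proof.
have [M HM] := inv_qpoch_bound q1; have [N HN] := inv_qpoch_bound Q1.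
have M0 : 0 <= M := le_trans (nr_ge0 _) (HM 0%N).
have t20 : - t ^+ 2 != 0 by rewrite oppr_eq0 expf_neq0.
have tq0 : - (t * q) != 0 by rewrite oppr_eq0 mulf_neq0.
have := asum_prod (asum_th q0 t20 q1) (asum_th q0 tq0 q1).
pose phi (u : nat * nat) : int * int := (u.2%:Z - u.1%:Z, u.1%:Z).
have phi_inj : injective phi.
  by move=> [k m] [k' m'] [] /= h1 h2; congr pair; lia.
move/(asum_comp phi_inj).
move/(@asum_bounded _ _ (fun u => (qpoch q q u.2)^-1 * (qpoch Q Q u.1)^-1) _ (M * N)).
have b u : nr ((qpoch q q u.2)^-1 * (qpoch Q Q u.1)^-1) <= M * N.
  by rewrite nrM ler_pM ?nr_ge0.
move/(_ b); congr asum; apply/funext => u; by rewrite cf_th.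
Qed.

(** Each factor reverses as 1 - t^2/q^j = -(t^2/q^j) (1 - q^j/t^2), and q^j/t^2 = t q^(j-1) because
    q = t^3. *)
Lemma qpoch_reflect k :
  qpoch (t ^+ 2 / q ^+ k) q k = qpoch t q k * mono t k (2 * k%:Z - 3 * 'C(k.+1, 2)%:Z).
Proof.
elim: k => [|k IH].
  by rewrite !qpoch0 mul1r /mono !expr0z mulr1.
rewrite qpochSl (_ : t ^+ 2 / q ^+ k.+1 * q = t ^+ 2 / q ^+ k); last first.
  by rewrite [q ^+ k.+1]exprS; have := expf_neq0 k q0; move: (q ^+ k) => z z0; field; rewrite z0 q0.
rewrite IH qpochS.
have -> : 1 - t ^+ 2 / q ^+ k.+1 = (1 - t * q ^+ k) * mono t 1 (2 - 3 * k.+1%:Z).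
  rewrite mono_Nt -mono_t -sqr_mono [q ^+ k.+1]exprS.
  have := expf_neq0 k q0; move: (q ^+ k) => z z0.
  transitivity (1 * (t ^+ 3 / q) - t ^+ 2 / (q * z)).
    by rewrite tq divff // mulr1.
  by field; rewrite z0 q0.
have -> : mono t k.+1 (2 * k.+1%:Z - 3 * 'C(k.+2, 2)%:Z) =
  mono t 1 (2 - 3 * k.+1%:Z) * mono t k (2 * k%:Z - 3 * 'C(k.+1, 2)%:Z).
  by rewrite monoM //; congr (mono t _ _); rewrite (binS k.+1 1) bin1; lia.
move: (qpoch _ _ _) (mono _ _ _) (mono _ _ _) => a b c; ring.
Qed.

(** Euler's identity sums over m to (t^2/q^k;q)_oo. Its first k factors are reflected into (t;q)_k,
    and the remaining ones form (t^2;q)_oo, independent of k. *)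
Lemma cf_row k : has_sum (fun m => cf (k, m)) (qpochinf (t ^+ 2) q * ft t q k).
Proof.
have e := euler_sum (x := t ^+ 2 / q ^+ k) q1.
set c := t ^- k * q ^+ (k * k + k) / qpoch Q Q k.
have -> : qpochinf (t ^+ 2) q * ft t q k = c * qpochinf (t ^+ 2 / q ^+ k) q.
  rewrite (qpochinf_cut (t ^+ 2 / q ^+ k) k q1) qpoch_reflect divfK ?expf_neq0 //.
  rewrite /c /ft tq_mono monoXn tV_mono !qX_mono.
  have E : mono t (1 * k%:Z) (4 * k%:Z) * mono t 0 (3 * 'C(k, 2)%:Z) =
    mono t 0 (- k%:Z) * mono t 0 (3 * (k * k + k)%:Z) *
    mono t k (2 * k%:Z - 3 * 'C(k.+1, 2)%:Z).
    rewrite !monoM //; congr (mono t _ _); first by lia.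
    by have := bin2_mul2 k; have := bin2_mul2 k.+1; nia.
  rewrite -[X in _ * (X / _)]mulrA E.
  by move: (qpoch _ _ _)^-1 (qpoch _ _ _) (qpochinf _ _) (mono _ _ _) (mono _ _ _) (mono _ _ _) => x y z u v w; ring.
apply: (eq_has_sum (has_sumZ c e)) => m; by rewrite mulrC.
Qed.

(** This constant depends on q alone, so it is common to the three cube roots. *)
Definition c0 : C :=
  qpochinf (q ^+ 4) (q ^+ 6) * qpochinf (- Q) Q / qpochinf (q ^+ 2) (q ^+ 2).

(** Jacobi's product with base q^2 and x = q t has q^2/x = t^2, so it contains exactly the two
    t-dependent factors (t q;q^2)_oo and (t^2;q^2)_oo left by [ft_sum]. *)
Lemma bt_sum : exists AJ : C * C,
  [/\ has_sum (th q (- (q * t))) AJ.1,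
      has_sum (th (q ^+ 2) (- (q * t))) AJ.2 & has_sum bt (c0 * (AJ.1 * AJ.2))].
Proof.
have t1 := root_lt1 tq q1.
have q21 : `|q ^+ 2| < 1 by exact: normXlt1.
have qt0 : - (q * t) != 0 by rewrite oppr_eq0 mulf_neq0.
have ath := asum_th q0 qt0 q1; have [A HA] := asum_has_sum ath.
have [S HS] := asum_has_sum asum_cf.
have HF := has_sum_fubini HS cf_row.
have p0 : qpochinf (t ^+ 2) q != 0 by apply: qpochinf_neq0 => //; exact: normXlt1.
have Hft : has_sum (ft t q) ((qpochinf (t ^+ 2) q)^-1 * S).
  by apply: (eq_has_sum (has_sumZ (qpochinf (t ^+ 2) q)^-1 HF)) => k; rewrite mulKf.
have := ft_sum t0 tq q1 Hft; rewrite mulrAC mulVf // mul1r => ES.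
have E2 : q ^+ 2 / (q * t) = t ^+ 2.
  by rewrite -tq; field; rewrite t0.
have HJ : has_sum (th (q ^+ 2) (- (q * t)))
   (qpochinf (q ^+ 2) (q ^+ 2) * qpochinf (q * t) (q ^+ 2) * qpochinf (t ^+ 2) (q ^+ 2)).
  rewrite -E2; apply: jacobi_triple => //; rewrite ?expf_neq0 ?mulf_neq0 //.
  by rewrite E2; exact: normXlt1.
eexists (A, _); split; [exact: HA | exact: HJ |].
have := has_sum_prod ath asum_cf HA HS.
congr has_sum; rewrite ES /c0 /= [t * q]mulrC.
have := qpochinf_neq0 q21 q21; move: (qpochinf (q ^+ 2) _) (qpochinf (q * t) _) (qpochinf (t ^+ 2) _).
move: (qpochinf (q ^+ 4) _) (qpochinf (- Q) _) => a b z c d z0.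
clear -z0; by field; rewrite z0.
Qed.

End CubeRootFamily.

(** * Averaging over the cube roots *)

Section RootsOfUnity.
Variable R : realType.
Local Notation C := (R[i] : numFieldType).
Variables t q w : C.
Hypotheses (t0 : t != 0) (tq : t ^+ 3 = q) (q1 : `|q| < 1).
Hypothesis w2 : 1 + w + w ^+ 2 = 0.
Local Notation Q := (q ^+ 3).

Let q0 : q != 0. Proof. by rewrite -tq expf_neq0. Qed.
Let Q0 : Q != 0. Proof. by rewrite expf_neq0. Qed.
Let Q1 : `|Q| < 1. Proof. exact: normXlt1. Qed.

Lemma cube_unity : w ^+ 3 = 1.
Proof.
apply/eqP; rewrite -subr_eq0; apply/eqP.
by transitivity ((w - 1) * (1 + w + w ^+ 2)); [ring | rewrite w2 mulr0].
Qed.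

Lemma unity_neq0 : w != 0.
Proof.
apply/negP => /eqP w0; have := cube_unity; rewrite w0 expr0n /= => /eqP.
by rewrite eq_sym oner_eq0.
Qed.

Lemma root_filter (n : int) :
  \sum_(j <- iota 0 3) (w ^+ j) ^ n = if (3 %| n)%Z then 3 else 0.
Proof.
have w0 := unity_neq0.
have E : w ^ n = w ^ (n %% 3)%Z.
  rewrite {1}(divz_eq n 3) expfzDr // [((n %/ 3)%Z * 3)]mulrC -exprz_exp.
  by rewrite -[w ^ 3]exprnP cube_unity exp1rz mul1r.
have F j : (w ^+ j) ^ n = (w ^ (n %% 3)%Z) ^+ j.
  by rewrite !exprnP exprz_exp mulrC -exprz_exp E.
rewrite !big_cons big_nil !F expr0 expr1 addr0.
have : (0 <= n %% 3)%Z by lia.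
have [d|] := boolP (3 %| n)%Z.
  by rewrite (_ : (n %% 3)%Z = 0) ?expr0z ?expr1n; [move=> _; ring | lia].
move=> d _; have [->|->] : (n %% 3)%Z = 1 \/ (n %% 3)%Z = 2 by lia.
  by rewrite expr1z addrA.
rewrite -[w ^ 2]exprnP; transitivity (1 + w + w ^+ 2 + w * (w ^+ 3 - 1)); first by ring.
by rewrite w2 cube_unity subrr mulr0 addr0.
Qed.

Lemma eulM (p x y : C) m : eul p (x * y) m = eul p x m * y ^+ m.
Proof. by rewrite !eulE exprMn mulrA. Qed.

Lemma th_root p (v : C) (n : int) : th p (- (q * (t * v))) n = th p (- (q * t)) n * v ^ n.
Proof. by rewrite mulrA -mulNr thM. Qed.

(** With N = M - k the exponent of v is N + 2m, congruent to N - m modulo 3; averaging over cube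
    roots of unity thus selects 3 | N - m. *)
Lemma bt_root (v : C) u : v != 0 ->
  bt (t * v) q u = bt t q u * v ^ (u.1 + 2 * u.2.2%:Z - u.2.1%:Z).
Proof.
move=> v0; case: u => M [k m] /=; rewrite /bt /cf /= th_root.
rewrite (_ : (t * v) ^+ 2 / q ^+ k = t ^+ 2 / q ^+ k * v ^+ 2); last first.
  by rewrite exprMn mulrAC.
rewrite (eulM q (t ^+ 2 / q ^+ k)).
have v2 : v ^ (2 * m%:Z) = v ^+ 2 ^+ m.
  by rewrite -exprM exprnP; congr (v ^ _); lia.
rewrite !expfzDr // v2 -exprnN [(t * v) ^+ k]exprMn invfM.
move: (th _ _ _) (v ^ M) (eul _ _ _) (v ^+ 2 ^+ m) (t ^+ k)^-1 (v ^+ k)^-1.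
move: (q ^+ (k * k + k)) (qpoch _ _ _)^-1 => a b c d e f g h; ring.
Qed.

(* B_t at (m + 3l, m, 0). *)
Definition dt (l : int) (m : nat) : C := th q (- (q * t)) (m%:Z + 3 * l) * eul q (t ^+ 2) m.

(** For N = m + 3l the coupling q^(k(N-m)) becomes Q^(kl), so the dependence on k is Euler's term
    for (Q^(l+1);Q)_oo. *)
Lemma bt_diag l m k : bt t q (m%:Z + 3 * l + k%:Z, (k, m)) = dt l m * eul Q (Q ^ (l + 1)) k.
Proof.
rewrite /bt /cf /dt /= eulM exprVn thD ?oppr_eq0 ?mulf_neq0 //.
rewrite (qt_mono tq) (th_q_mono t0 tq _ _ k) (tV_mono t) (eulE Q) (qX_mono tq (k * k + k)).
rewrite [(-1) ^+ k]exprnP -(mono_N1 t).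
have qz (n : int) : q ^ n = mono t 0 (3 * n) by rewrite {1}(q_mono tq) monoX mul0r.
have -> : (q ^+ k ^+ m)^-1 = mono t 0 (- 3 * (k%:Z * m%:Z)).
  by rewrite -exprM exprnN qz; congr (mono t _ _); lia.
have -> : Q ^+ 'C(k, 2) = mono t 0 (9 * (binz k)%:Z).
  by rewrite -exprM (qX_mono tq); congr (mono t _ _); rewrite /=; lia.
have -> : (Q ^ (l + 1)) ^+ k = mono t 0 (9 * (l + 1) * k%:Z).
  by rewrite exprnP exprz_exp exprnP exprz_exp qz; congr (mono t _ _); lia.
rewrite qz.
have E : mono t (1 * k%:Z) (3 * (binz k)%:Z + 4 * k%:Z) *
   mono t 0 (3 * ((m%:Z + 3 * l) * k%:Z)) * mono t 0 (- 3 * (k%:Z * m%:Z)) *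
   mono t 0 (- k%:Z) * mono t 0 (3 * (k * k + k)%:Z) =
   mono t 0 (9 * (binz k)%:Z) * mono t k 0 * mono t 0 (9 * (l + 1) * k%:Z).
  rewrite !monoM //; congr (mono t _ _); first by lia.
  by have := binz2 k; nia.
transitivity (th q (mono t 1 4) (m%:Z + 3 * l) * eul q (t ^+ 2) m / qpoch Q Q k *
  (mono t 0 (9 * (binz k)%:Z) * mono t k 0 * mono t 0 (9 * (l + 1) * k%:Z))); last by ring.
by rewrite -E; ring.
Qed.

Lemma dt_double m n : dt n%:Z m / qpoch Q Q n = double_summand q (m, n).
Proof.
rewrite /dt /double_summand (qt_mono tq) (th_q_mono t0 tq) eulE.
rewrite (qX_mono tq 'C(m, 2)) [q ^+ (_ + 7 * n)](qX_mono tq).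
rewrite -[t ^+ 2 ^+ m]exprM [t ^+ (2 * m)]exprnP -(mono_t t).
rewrite ![(-1) ^+ _]exprnP -!(mono_N1 t) invfM.
have E : mono t (1 * (m%:Z + 3 * n%:Z)) (3 * (binz (m%:Z + 3 * n%:Z))%:Z + 4 * (m%:Z + 3 * n%:Z)) *
   mono t 0 (3 * 'C(m, 2)%:Z) * mono t m 0 * mono t 0 (2 * m)%:Z =
   mono t n 0 * mono t 0 (3 * (2 * 'C(m, 2) + 9 * 'C(n, 2) + 3 * m * n + 2 * m + 7 * n)%N%:Z).
  (* The signs agree since 2m + 3n = n + 2(m + n). *)
  rewrite !monoM // -[RHS](mono_sign t _ (m%:Z + n%:Z)); congr (mono t _ _); first by lia.
  have := binz2 (m%:Z + 3 * n%:Z); have := bin2_mul2 m; have := bin2_mul2 n.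
  by nia.
rewrite [mono t n 0 * _ * _]mulrA -E.
by move: (mono _ _ _) (qpoch _ _ _)^-1 => a b; ring.
Qed.

Lemma double_summand_sum (X : C) :
  has_sum (fun u => \sum_(j <- iota 0 3) bt (t * w ^+ j) q u) X ->
  has_sum (double_summand q) ((3 * qpochinf Q Q)^-1 * X).
Proof.
have w0 := unity_neq0.
set f := (X in has_sum X _) => Hf.
have fE u : f u = bt t q u * (if (3 %| u.1 + 2 * u.2.2%:Z - u.2.1%:Z)%Z then 3 else 0).
  rewrite -root_filter mulr_sumr; apply: eq_bigr => j _.
  by rewrite bt_root // expf_neq0.
(* The triple (l, m, k) parametrizes exactly the surviving indices, those with N = m + 3l. *)
pose phi (u : int * nat * nat) : int * (nat * nat) :=
  (u.1.2%:Z + 3 * u.1.1 + u.2%:Z, (u.2, u.1.2)).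
pose psi (u : int * (nat * nat)) : int * nat * nat :=
  (((u.1 - u.2.1%:Z - u.2.2%:Z) %/ 3)%Z, u.2.2, u.2.1).
have phiK : cancel phi psi.
  by move=> [[l m] k]; rewrite /phi /psi /=; clear; congr (_, _, _); lia.
have f0 u : phi (psi u) != u -> f u = 0.
  case: u => M [k m]; rewrite fE /phi /psi /= => h.
  case: ifP => d; last by rewrite mulr0.
  by case/eqP: h; move: d; clear; move=> d; congr pair; lia.
have [/(_ Hf) H1 _] := has_sum_reindex X phiK f0.
have rows (lm : int * nat) : has_sum (fun k => (f \o phi) (lm, k))
    (3 * dt lm.1 lm.2 * qpochinf (Q ^ (lm.1 + 1)) Q).
  have e := euler_sum (x := Q ^ (lm.1 + 1)) Q1.
  apply: (eq_has_sum (has_sumZ (3 * dt lm.1 lm.2) e)) => k.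
  case: lm {e} => l m; rewrite /= fE /phi /= bt_diag ifT; last by clear; lia.
  by move: (dt _ _) (eul _ _ _) => a b; ring.
have H2 := has_sum_fubini H1 rows.
(* Rows with l < 0 vanish, so l becomes the natural index n of the double sum. *)
pose phi2 (u : nat * nat) : int * nat := (u.2%:Z, u.1).
pose psi2 (u : int * nat) : nat * nat := (u.2, absz u.1).
have phi2K : cancel phi2 psi2 by case.
have g0 lm : phi2 (psi2 lm) != lm ->
    3 * dt lm.1 lm.2 * qpochinf (Q ^ (lm.1 + 1)) Q = 0.
  case: lm => -[l|l] m; rewrite /phi2 /psi2 /= ?abszE ?eqxx // => _.
  by rewrite qpochinf_expz // mulr0.
have [/(_ H2) H3 _] := has_sum_reindex X phi2K g0.
apply: (eq_has_sum (has_sumZ (3 * qpochinf Q Q)^-1 H3)) => -[m n].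
rewrite -dt_double /= qpochinf_expz //.
have := qpochinf_neq0 Q1 Q1; have : qpoch Q Q n != 0 by exact: qpoch_neq0.
move: (qpochinf _ _) (qpoch _ _ _) (dt _ _) => a b c a0 b0.
by field; rewrite a0 b0.
Qed.

Lemma theta_product_sum (A J : nat -> C) :
  (forall j, has_sum (th q (- (q * (t * w ^+ j)))) (A j)) ->
  (forall j, has_sum (th (q ^+ 2) (- (q * (t * w ^+ j)))) (J j)) ->
  \sum_(j <- iota 0 3) A j * J j =
  3 * ((qpochinf (q ^+ 6) (q ^+ 6) * qpochinf (q ^+ 5) (q ^+ 6) * qpochinf q (q ^+ 6)) *
       (qpochinf Q Q * qpochinf (- q) Q * qpochinf (- q ^+ 2) Q)).
Proof.
have w0 := unity_neq0.
have q20 : q ^+ 2 != 0 by rewrite expf_neq0.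
have q21 : `|q ^+ 2| < 1 by exact: normXlt1.
have q60 : q ^+ 6 != 0 by rewrite expf_neq0.
have q61 : `|q ^+ 6| < 1 by exact: normXlt1.
have q50 : q ^+ 5 != 0 by rewrite expf_neq0.
have Nq50 : - q ^+ 5 != 0 by rewrite oppr_eq0.
have Nq0 : - q != 0 by rewrite oppr_eq0.
have E6 : q ^+ 6 / q ^+ 5 = q by rewrite [q ^+ 6]exprS mulfK.
have E3 : Q / - q = - q ^+ 2 by rewrite exprSr invrN mulrN mulfK.
have n6 : `|q ^+ 6 / q ^+ 5| < 1 by rewrite E6.
have n3 : `|Q / - q| < 1 by rewrite E3 normrN.
have := jacobi_triple q60 q50 q61 n6; rewrite E6 => j6.
have := jacobi_triple Q0 Nq0 Q1 n3; rewrite opprK E3 => j3.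
move=> HA HJ.
have r0 j : - (q * (t * w ^+ j)) != 0 by rewrite oppr_eq0 !mulf_neq0 ?expf_neq0.
have Hp j := has_sum_prod (asum_th q0 (r0 j) q1) (asum_th q20 (r0 j) q21) (HA j) (HJ j).
have := has_sum_bigop (iota 0 3) Hp.
set f := (X in has_sum X _) => Hf.
have fE u : f u = th q (- (q * t)) u.1 * th (q ^+ 2) (- (q * t)) u.2 *
   (if (3 %| u.1 + u.2)%Z then 3 else 0).
  rewrite -root_filter mulr_sumr; apply: eq_bigr => j _.
  rewrite !th_root expfzDr ?expf_neq0 //.
  by move: (th _ _ _) (th _ _ _) (_ ^ _) (_ ^ _) => a b c d; ring.
(* The image is the sublattice of index 3 where the two indices sum to a multiple of 3, here 3l. The
   substitution removes the cross term from the exponent of q, which becomes 3l^2 + 2l + (3k^2 -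
   k)/2. *)
pose phi (u : int * int) : int * int := (2 * u.1 - u.2, u.1 + u.2).
pose psi (u : int * int) : int * int :=
  (((u.1 + u.2) %/ 3)%Z, u.2 - ((u.1 + u.2) %/ 3)%Z).
have phiK : cancel phi psi.
  by move=> [l k]; rewrite /phi /psi /=; clear; congr pair; lia.
have f0 u : phi (psi u) != u -> f u = 0.
  case: u => N k; rewrite fE /phi /psi /= => h.
  case: ifP => d; last by rewrite mulr0.
  by case/eqP: h; move: d; clear; move=> d; congr pair; lia.
have [/(_ Hf) H1 _] := has_sum_reindex (\sum_(j <- iota 0 3) A j * J j) phiK f0.
apply: (has_sum_unique H1).
have := has_sumZ 3 (has_sum_prod (asum_th q60 Nq50 q61) (asum_th Q0 q0 Q1) j6 j3).
move/eq_has_sum; apply => -[l k] /=; rewrite fE /phi /= ifT; last by clear; lia.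
have qX n := qX_mono tq n.
have N5 : - q ^+ 5 = mono t 1 15 by rewrite qX mono_Nt mono_t.
rewrite N5 (qt_mono tq) (th_q_mono t0 tq) !qX (q_mono tq) !th_mono //.
rewrite !monoM // mulrC; congr (_ * _).
rewrite -[LHS](mono_sign t _ l); clear; congr (mono t _ _); first by lia.
have := binz2 l; have := binz2 k; have := binz2 (l + k); have := binz2 (2 * l - k).
by nia.
Qed.

End RootsOfUnity.

(** * Assembling the final product *)

Section Assembly.
Variable R : realType.
Local Notation C := (R[i] : numFieldType).
Variable q : C.
Hypothesis q1 : `|q| < 1.
Local Notation Q := (q ^+ 3).

(** Write (q^2;q^2)_oo as (q;q)_oo (-q;q)_oo, then split the first factor into six residue classes
    and the second into three. Everything cancels except the classes of q^2 and q^3. *)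
Lemma final_product :
  c0 q * (qpochinf (q ^+ 6) (q ^+ 6) * qpochinf (q ^+ 5) (q ^+ 6) * qpochinf q (q ^+ 6) *
          (qpochinf (- q) Q * qpochinf (- q ^+ 2) Q)) =
  1 / (qpochinf (q ^+ 2) (q ^+ 6) * qpochinf Q (q ^+ 6)).
Proof.
have q6 : `|q ^+ 6| < 1 by exact: normXlt1.
have q3 : `|Q| < 1 by exact: normXlt1.
have a0 n : qpochinf (q ^+ n.+1) (q ^+ 6) != 0 by apply: qpochinf_neq0 => //; exact: normXlt1.
have m0 n : qpochinf (- q ^+ n.+1) Q != 0.
  by apply: qpochinf_neq0 => //; rewrite normrN; exact: normXlt1.
rewrite /c0 -(qpochinf_sqr q q1) (qpochinf_split3 (- q) q1) (qpochinf_split 5 q q1).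
rewrite !big_ord_recr big_ord0 /= mul1r expr0 mulr1 expr1 !mulNr -!exprS.
have := a0 0%N; rewrite expr1; have := m0 0%N; rewrite expr1.
move: (a0 1%N) (a0 2%N) (a0 3%N) (a0 4%N) (a0 5%N) (m0 1%N) (m0 2%N).
rewrite -[q * q]expr2.
move: (qpochinf q _) (qpochinf (- q) _) (qpochinf (q ^+ 2) _) (qpochinf Q _).
move: (qpochinf (q ^+ 4) _) (qpochinf (q ^+ 5) _) (qpochinf (q ^+ 6) _).
move: (qpochinf (- q ^+ 2) _) (qpochinf (- Q) _); clear.
move=> m2 m3 a4 a5 a6 a1 m1 a2 a3 h1 h2 h3 h4 h5 h6 h7 h8 h9.
by field; rewrite h1 h2 h3 h4 h5 h6 h7 h8 h9.
Qed.

Lemma cube_unity_exists : exists w : C, 1 + w + w ^+ 2 = 0.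
Proof.
pose s : C := sqrtC (- 3 : R[i]).
have s2 : s ^+ 2 = - 3 by exact: sqrtCK.
exists ((-1 + s) / 2); transitivity ((s ^+ 2 + 3) / 4); first by field.
by rewrite s2 addNr mul0r.
Qed.

(** The triple sums at t w^j for j = 0, 1, 2 are added: [double_summand_sum] reads the total as the
    double sum, [theta_product_sum] as a product. *)
Lemma double_sum_neq0 : q != 0 -> has_sum (double_summand q)
  (1 / (qpochinf (q ^+ 2) (q ^+ 6) * qpochinf Q (q ^+ 6))).
Proof.
move=> q0; have Q1 : `|Q| < 1 by exact: normXlt1.
pose t : C := 3.-root (q : R[i]).
have tq : t ^+ 3 = q by exact: rootCK.
have t0 : t != 0 by apply: contra_neq q0 => t0; rewrite -tq t0 expr0n.
have [w w2] := cube_unity_exists.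
have w0 := unity_neq0 w2.
have tj0 j : t * w ^+ j != 0 by rewrite mulf_neq0 ?expf_neq0.
have tjq j : (t * w ^+ j) ^+ 3 = q.
  by rewrite exprMn -exprM mulnC exprM (cube_unity w2) expr1n mulr1.
have /choice[AJ HAJ] j := bt_sum (tj0 j) (tjq j) q1.
have HA j : has_sum (th q (- (q * (t * w ^+ j)))) (AJ j).1.
  by have [h _ _] := HAJ j; exact h.
have HJ j : has_sum (th (q ^+ 2) (- (q * (t * w ^+ j)))) (AJ j).2.
  by have [_ h _] := HAJ j; exact h.
have HB j : has_sum (bt (t * w ^+ j) q) (c0 q * ((AJ j).1 * (AJ j).2)).
  by have [_ _ h] := HAJ j; exact h.
have := double_summand_sum t0 tq q1 w2 (has_sum_bigop (iota 0 3) HB).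
rewrite -mulr_sumr (theta_product_sum t0 tq q1 w2 HA HJ) -final_product.
congr has_sum; have := qpochinf_neq0 Q1 Q1.
move: (qpochinf Q Q) (c0 q) (qpochinf _ _) (qpochinf _ _) (qpochinf _ _).
move: (qpochinf _ _) (qpochinf _ _); clear => a b c d e f g h0.
by field; rewrite h0.
Qed.

Lemma qpochinf0 p : `|p| < 1 -> qpochinf (0 : C) p = 1.
Proof.
move=> p1; apply: (seqlim_unique (qpoch_cvg (x := 0) p1)).
apply: (eq_seqlim (seqlim_cst (1 : C))) => n.
by rewrite /qpoch big1 // => i _; rewrite mul0r subr0.
Qed.

(** The main argument divides by q, so q = 0 is treated apart: the exponent is positive except at
    (0, 0), where 0^0 = 1 leaves the single term 1. *)
Lemma double_sum_eq0 : q = 0 -> has_sum (double_summand q)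
  (1 / (qpochinf (q ^+ 2) (q ^+ 6) * qpochinf Q (q ^+ 6))).
Proof.
move=> ->; have z n : (0 : C) ^+ n.+1 = 0 by rewrite expr0n.
rewrite !z qpochinf0 ?normr0 // mulr1 divr1.
have H1 : has_sum (fun u : nat * nat => if u == (0%N, 0%N) then 1 : C else 0) 1.
  exact: has_sum1.
apply: (eq_has_sum H1) => -[m n] /=.
case: eqP => [[-> ->]|mn].
  by rewrite (_ : (_ + 7 * 0)%N = 0%N) // !expr0 !qpoch0 !mulr1 divr1.
rewrite (_ : (_ + 7 * n)%N = (2 * 'C(m, 2) + 9 * 'C(n, 2) + 3 * m * n + 2 * m + 7 * n).-1.+1).
  by rewrite z mulr0 mul0r.
rewrite prednK //; case: m n mn => [|m] [|n] mn; first by case: mn.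
- by rewrite !addn_gt0 [(0 < 7 * _)%N]muln_gt0 orbT.
- by rewrite !addn_gt0 [(0 < 2 * m.+1)%N]muln_gt0 orbT.
- by rewrite !addn_gt0 [(0 < 7 * _)%N]muln_gt0 orbT.
Qed.

End Assembly.

Theorem theorem1p4 (R : realType) (q : R[i]) (hq : `|q| < 1) :
  partial_sum (double_summand q) @ totally -->
    1 / qpochsinf [:: q ^+ 2; q ^+ 3] (q ^+ 6).
Proof.
rewrite /qpochsinf !big_cons big_nil mulr1.
have [q0|q0] := eqVneq q 0; first exact: double_sum_eq0.
exact: double_sum_neq0.
Qed.
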